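(* Let $\{D_x : x\in M^l\}$ be a definable family of subsets of $M^k$. Then for any $d\leq k$, the set of parameters $x\in M^l$ for which $\dim(D_x)=d$ is definable.
   Context: Setting. $T$ is a complete NIP theory in a multi-sorted language $L$ with a distinguished home sort, $\mathcal M$ is an $|L|^+$-saturated model of $T$, and $M$ is the home sort of $\mathcal M$. ''Definable'' means definable in $\mathcal M$, possibly with parameters. A definable set $A$ has dp-rank greater than $n$ if for $0 \le i \le n$ there are formulas $\phi_i(x,y_i)$ (parameters allowed) and infinite sets $B_i$ of tuples (from the sorts of $y_i$) such that for every $(b_0,\dots,b_n) \in B_0\times\cdots\times B_n$ there is $a \in A$ such that for all $0 \le i \le n$ and $y \in B_i$: $\mathcal M \models \phi_i(a,y)$ if and only if $y=b_i$. A nonempty set has dp-rank at least $0$. $\mathcal M$ is assumed dp-minimal: $M$ has dp-rank $1$. $M$ is equipped with a definable uniform structure $\mathcal B$: a collection of subsets of $M^2$ of the form $\mathcal B=\{\varphi(M^2,\bar c): \bar c \in D\}$ for some formula $\varphi(x,y,\bar z)$ and some definable set $D$, such that (i) $\bigcap \mathcal B$ is the diagonal of $M^2$; (ii) each $U\in\mathcal B$ is symmetric; (iii) for all $U,V \in \mathcal B$ there is $W \in \mathcal B$ with $W \subseteq U\cap V$; (iv) for all $U \in \mathcal B$ there is $V\in\mathcal B$ with $V \circ V \subseteq U$, where $U\circ V=\{(x,z): \exists y\ (x,y)\in U,\ (y,z)\in V\}$. For $x\in M$ put $U[x]=\{y:(x,y)\in U\}$; $M$ has the topology in which a set is open iff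 it contains some $U[x]$ ($U\in\mathcal B$) around each of its points $x$, and $M^k$ has the product topology. It is assumed that $M$ has no isolated points and that every infinite definable subset of $M$ has nonempty interior. Dimension. For a tuple $\bar a \in M^k$ and a small (of cardinality at most $|L|$) parameter set $C$, $\dim(\bar a/C)$ is the minimal $l$ such that some subtuple $\bar a'$ of $\bar a$ of length $l$ satisfies $\bar a \in \mathrm{acl}(C\bar a')$. For a $C$-definable set $A\subseteq M^k$, $\dim(A)=\max\{\dim(\bar a/C):\bar a\in A\}$; it does not depend on the choice of small $C$ over which $A$ is definable. $\dim(\emptyset)=-\infty$. *)

(* Defs.v *)
From mathcomp Require Import all_boot.
From mathcomp Require Import boolp classical_sets functions cardinality.

Set Implicit Arguments.
Unset Strict Implicit.
Unset Printing Implicit Defensive.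

Local Open Scope classical_set_scope.

Declare Scope model_scope.
Delimit Scope model_scope with mod.

(* A finite tuple of variables together with their sorts.  The positions of a
   concatenated tuple form a disjoint sum rather than an initial segment of
   nat, so that assignments can be concatenated without casts. *)
Inductive ctx (S : Type) : Type :=
| Nil
| Tup (n : nat) (s : 'I_n -> S)
| Cat (G D : ctx S).
Arguments Nil {S}.

Fixpoint idx (S : Type) (G : ctx S) : Type :=
  match G with
  | Nil => void
  | Tup n _ => 'I_n
  | Cat G D => (idx G + idx D)%type
  end.

Fixpoint sort_of (S : Type) (G : ctx S) : idx G -> S :=
  match G return idx G -> S with
  | Nil => fun v => match v with end
  | Tup n s => s
  | Cat G D => fun i => match i with inl x => sort_of x | inr y => sort_of y end
  end.

Definition power {S : Type} (s : S) (k : nat) : ctx S := @Tup S k (fun=> s).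

Definition single {S : Type} (s : S) : ctx S := power s 1.

Notation "G (+) D" := (Cat G D) : model_scope.
Local Open Scope model_scope.

Record language := Language {
  lsort : Type;
  home : lsort;
  fsym : Type;
  farity : fsym -> ctx lsort;
  fres : fsym -> lsort;
  rsym : Type;
  rarity : rsym -> ctx lsort }.

Inductive term (L : language) (G : ctx (lsort L)) : lsort L -> Type :=
| Var (i : idx G) : term G (sort_of i)
| App (f : fsym L) (args : forall i : idx (farity f), term G (sort_of i)) :
    term G (fres f).

(* The remaining connectives are abbreviations, the semantics being classical;
   All binds the variable added on the right of the context. *)
Inductive formula (L : language) (G : ctx (lsort L)) : Type :=
| Fls
| Eq (s : lsort L) (t u : term G s)
| Rel (r : rsym L) (args : forall i : idx (rarity r), term G (sort_of i))
| Imp (phi psi : formula G)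
| All (s : lsort L) (phi : formula (G (+) single s)).

Definition sentence (L : language) := formula (@Nil (lsort L)).

Definition Neg (L : language) (G : ctx (lsort L)) (phi : formula G) : formula G :=
  Imp phi (Fls G).

(* The type whose cardinality is |L|: all L-formulas in finitely many free
   variables.  It is always infinite. *)
Definition any_formula (L : language) : Type :=
  {n : nat & {s : 'I_n -> lsort L & formula (@Tup (lsort L) n s)}}.

(* [env X G]: assignments of the variables of G, i.e. the product of the
   corresponding sorts; env X (power s k) is 'I_k -> X s. *)
Definition env (S : Type) (X : S -> Type) (G : ctx S) : Type :=
  forall i : idx G, X (sort_of i).

Definition empty_env {S : Type} (X : S -> Type) : env X Nil :=
  fun v => match v with end.

Definition cat_env {S : Type} {X : S -> Type} {G D : ctx S}
    (e : env X G) (f : env X D) : env X (G (+) D) :=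
  fun i => match i with inl x => e x | inr y => f y end.

Notation "e +++ f" := (cat_env e f) (at level 50, left associativity)
  : model_scope.

Definition env1 {S : Type} {X : S -> Type} {s : S} (a : X s) : env X (single s) :=
  fun=> a.

Record structure (L : language) := Structure {
  carrier :> lsort L -> Type;
  carrier_nonempty : forall s, inhabited (carrier s);
  finterp : forall f : fsym L, env carrier (farity f) -> carrier (fres f);
  rinterp : forall r : rsym L, env carrier (rarity r) -> Prop }.

Section Semantics.
Variables (L : language) (M : structure L).
Implicit Types G D : ctx (lsort L).

Fixpoint eval G (e : env M G) (s : lsort L) (t : term G s) : M s :=
  match t in term _ s return M s with
  | Var i => e i
  | App f args => @finterp L M f (fun i => eval e (args i))
  end.

Fixpoint sat G (phi : formula G) : env M G -> Prop :=
  match phi with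
  | Fls => fun=> False
  | Eq s t u => fun e => eval e t = eval e u
  | Rel r args => fun e => @rinterp L M r (fun i => eval e (args i))
  | Imp phi psi => fun e => sat phi e -> sat psi e
  | All s phi => fun e => forall a : M s, sat phi (e +++ env1 a)
  end.

Definition holds (phi : sentence L) : Prop := sat phi (@empty_env _ M).

(* Elements of M of arbitrary sort; parameter sets are sets of these. *)
Definition element : Type := {s : lsort L & M s}.

Definition elt (s : lsort L) (a : M s) : element := existT (fun s => M s) s a.

Definition small (C : set element) : Prop := (C #<= [set: any_formula L])%card.

(* Formulas with parameters: an L-formula some of whose variables have been
   replaced by elements of M. *)
Record pformula G := PFormula {
  pctx : ctx (lsort L);
  pform : formula (G (+) pctx);
  params : env M pctx }.
Arguments params {G} p _.

Definition psat G (phi : pformula G) (a : env M G) : Prop :=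
  sat (pform phi) (a +++ params phi).

Definition with_params (C : set element) G (phi : pformula G) : Prop :=
  forall j, C (elt (params phi j)).

Definition definable_over (C : set element) G (A : set (env M G)) : Prop :=
  exists2 phi : pformula G, with_params C phi & A = [set a | psat phi a].

Definition definable G (A : set (env M G)) : Prop := definable_over setT A.

(* Every type in finitely many variables over at most |L| parameters is
   realized, i.e. M is |L|^+-saturated. *)
Definition saturated : Prop :=
  forall (C : set element) G (p : set (pformula G)),
    small C -> p `<=` with_params C (G:=G) ->
    (forall q : set (pformula G), finite_set q -> q `<=` p ->
       exists a, forall phi, q phi -> psat phi a) ->
    exists a, forall phi, p phi -> psat phi a.

(* Shelah's finitary form: for every n some n tuples are shattered by phi. *)
Definition has_IP G D (phi : formula (G (+) D)) : Prop :=
  forall n : nat, exists a : 'I_n -> env M G, forall w : set 'I_n,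
    exists b : env M D, forall i, sat phi (a i +++ b) <-> w i.

Definition dp_rank_gt G (A : set (env M G)) (n : nat) : Prop :=
  exists (D : 'I_n.+1 -> ctx (lsort L)) (phi : forall i, pformula (G (+) D i))
         (B : forall i, set (env M (D i))),
    (forall i, infinite_set (B i)) /\
    forall b : (forall i, env M (D i)), (forall i, B i (b i)) ->
      exists2 a, A a &
        forall i y, B i y -> (psat (phi i) (a +++ y) <-> y = b i).

Definition dp_rank_ge G (A : set (env M G)) (n : nat) : Prop :=
  if n is m.+1 then dp_rank_gt A m else A !=set0.

Definition dp_rank_eq G (A : set (env M G)) (n : nat) : Prop :=
  dp_rank_ge A n /\ ~ dp_rank_gt A n.

Local Notation H := (M (home L)).
Local Notation h := (single (home L)).

Definition dp_minimal : Prop := dp_rank_eq [set: env M h] 1.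

Definition definable_subset (X : set H) : Prop :=
  definable [set e : env M h | X (e ord0)].

Definition comp_rel (U V : set (H * H)) : set (H * H) :=
  [set xz | exists y, U (xz.1, y) /\ V (y, xz.2)].

Record definable_uniform_structure (B : set (set (H * H))) : Prop := {
  unif_definable :
    exists (Z : ctx (lsort L)) (phi : pformula (h (+) h (+) Z)) (D : set (env M Z)),
      definable D /\
      B = [set U | exists2 c, D c &
             U = [set xy | psat phi (env1 xy.1 +++ env1 xy.2 +++ c)]];
  unif_diag : \bigcap_(U in B) U = [set xy | xy.1 = xy.2];
  unif_sym : forall U, B U -> forall x y, U (x, y) -> U (y, x);
  unif_cap : forall U V, B U -> B V -> exists2 W, B W & W `<=` U `&` V;
  unif_comp : forall U, B U -> exists2 V, B V & comp_rel V V `<=` U }.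

Definition unif_open (B : set (set (H * H))) (O : set H) : Prop :=
  forall x, O x -> exists2 U, B U & [set y | U (x, y)] `<=` O.

Definition unif_interior (B : set (set (H * H))) (X : set H) : set H :=
  [set x | exists O, [/\ unif_open B O, O `<=` X & O x]].

Definition no_isolated_points (B : set (set (H * H))) : Prop :=
  forall x, ~ unif_open B [set x].

Definition infinite_definable_interior (B : set (set (H * H))) : Prop :=
  forall X : set H, definable_subset X -> infinite_set X ->
    unif_interior B X !=set0.

Definition acl (C : set element) : set element :=
  [set p | exists phi : pformula (single (projT1 p)),
     [/\ with_params C phi,
         finite_set [set b | psat phi (env1 b)] & psat phi (env1 (projT2 p))]].

Definition subtuple_set k (a : env M (power (home L) k)) (I : {set 'I_k}) :
    set element :=
  [set p | exists2 i, i \in I & p = elt (a i)].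

Definition acl_spans (C : set element) k (a : env M (power (home L) k))
    (I : {set 'I_k}) : Prop :=
  forall j, acl (C `|` subtuple_set a I) (elt (a j)).

(* dim(a / C) = n *)
Definition tuple_dim (C : set element) k (a : env M (power (home L) k)) (n : nat) :
    Prop :=
  (exists2 I, acl_spans C a I & #|I| = n) /\
  (forall I, acl_spans C a I -> n <= #|I|).

(* dim(A) = d as computed over C, None standing for -oo *)
Definition dim_over (C : set element) k (A : set (env M (power (home L) k)))
    (d : option nat) : Prop :=
  if d is Some n then
    (exists2 a, A a & tuple_dim C a n) /\
    (forall a m, A a -> tuple_dim C a m -> m <= n)
  else A = set0.

(* dim(A) = d; the value does not depend on the choice of C *)
Definition dim k (A : set (env M (power (home L) k))) (d : option nat) : Prop :=
  exists C, [/\ small C, definable_over C A & dim_over C A d].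

Definition definable_family l k
    (D : env M (power (home L) l) -> set (env M (power (home L) k))) : Prop :=
  exists phi : pformula (power (home L) l (+) power (home L) k),
    forall x, D x = [set a | psat phi (x +++ a)].

End Semantics.

Arguments params {L M G} p _.

Definition models (L : language) (M : structure L) (T : set (sentence L)) : Prop :=
  forall phi, T phi -> holds M phi.

Definition entails (L : language) (T : set (sentence L)) (phi : sentence L) : Prop :=
  forall N : structure L, models N T -> holds N phi.

Definition complete (L : language) (T : set (sentence L)) : Prop :=
  (exists N : structure L, models N T) /\
  forall phi, entails T phi \/ entails T (Neg phi).

Definition NIP (L : language) (T : set (sentence L)) : Prop :=
  forall (N : structure L), models N T ->
  forall (G D : ctx (lsort L)) (phi : formula (G (+) D)), ~ has_IP N phi.

(* Main.v *)
Require Import Defs.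
From Stdlib Require List.
From mathcomp Require Import all_boot.
From mathcomp Require Import boolp classical_sets functions cardinality.
Set Implicit Arguments.
Unset Strict Implicit.
Unset Printing Implicit Defensive.
Local Open Scope classical_set_scope.
Local Open Scope model_scope.

(** For a definable A in M^k, dim A >= n if and only if some projection of A to n coordinates
    contains a box of balls U[p_1] x ... x U[p_n], a condition which is definable in families.

    Let a in X in M^n, with X definable over C and no a_i algebraic over C and the other a_j.
    To find a box in X, take by induction large finite grids of points y such that (a_1, y) is
    in X and a_1 is not algebraic over C y.  If a_1 is in the interior of every fibre X^y, then
    finite intersections of these fibres are infinite, hence contain a ball, and compactness
    turns ball x grids into ball x box.  The difficulty is that the uniformity is defined with
    parameters e over which a_1 may become algebraic.  But two conjugate uniformities e, e'
    induce different neighbourhood filters at a bounded finite number of points only, and the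
    same filter at each x algebraic over neither e nor e': from m bad points for (e, e') one
    would get 2m bad points for (e, e''), where e'' is a conjugate of e over e' in general
    position.  So one may use, for each y, a conjugate of e over which a_1 stays generic.

    Conversely a box contains tuples independent over any small C (counting on a grid).  If
    both coordinates of an independent pair were algebraic over one t in M, then locally each
    point of a box in M^2 would come from some t, which is an array of dp-rank 2.  Counting
    minimal spanning subtuples, an independent n-tuple is then never algebraic over fewer than
    n elements. *)

Local Notation fext := functional_extensionality_dep.

(** * Substitution of terms for variables *)

Section Substitution.
Variable L : language.
Implicit Types G D K : ctx (lsort L).

Fixpoint tsubst G D (sg : forall i : idx G, term D (sort_of i)) s (t : term G s) :
    term D s :=
  match t in term _ s return term D s with
  | Var i => sg i
  | App f args => App (fun i => tsubst sg (args i))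
  end.

Definition weaken G s (s' : lsort L) (t : term G s) : term (G (+) single s') s :=
  tsubst (fun i => @Var L (G (+) single s') (inl i)) t.

Definition lift_subst G D s (sg : forall i : idx G, term D (sort_of i)) :
    forall i : idx (G (+) single s), term (D (+) single s) (sort_of i) :=
  fun i => match i with
           | inl x => weaken s (sg x)
           | inr y => @Var L (D (+) single s) (inr y)
           end.

(** The target context and the substitution come after phi because both change under [All]. *)
Fixpoint fsubst G (phi : formula G) :
    forall D, (forall i : idx G, term D (sort_of i)) -> formula D :=
  match phi with
  | Fls => fun D sg => Fls D
  | Eq s t u => fun D sg => Eq (tsubst sg t) (tsubst sg u)
  | Rel r args => fun D sg => Rel (fun i => tsubst sg (args i))
  | Imp p q => fun D sg => Imp (fsubst p sg) (fsubst q sg)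
  | All s p => fun D sg => All (fsubst p (lift_subst (s := s) sg))
  end.

Variable M : structure L.

Lemma eval_tsubst G D (sg : forall i : idx G, term D (sort_of i)) s (t : term G s)
    (e : env M D) :
  eval e (tsubst sg t) = eval (fun i => eval e (sg i)) t.
Proof.
elim: t => //= f args IH; congr (finterp _); apply: fext => i.
exact: IH.
Qed.

Lemma sat_fsubst G (phi : formula G) D (sg : forall i : idx G, term D (sort_of i))
    (e : env M D) :
  sat (fsubst phi sg) e <-> sat phi (fun i => eval e (sg i)).
Proof.
elim: phi D sg e => [G'|G' s t u|G' r args|G' p IHp q IHq|G' s p IHp] D sg e //=.
- by rewrite !eval_tsubst.
- suff -> : (fun i => eval e (tsubst sg (args i))) =
             (fun i => eval (fun j => eval e (sg j)) (args i)) by [].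
  by apply: fext => i; rewrite eval_tsubst.
- by rewrite IHp IHq.
- have E a : (fun i => eval (e +++ env1 a) (lift_subst sg i)) =
            (fun i => eval e (sg i)) +++ env1 a.
    by apply: fext => -[i|i] //=; rewrite /weaken eval_tsubst.
  by split => h a; have := h a; rewrite IHp E.
Qed.

End Substitution.

(** * Closure properties of definable predicates *)

Section Definability.
Variables (L : language) (M : structure L).
Implicit Types (C : set (element M)) (G D K : ctx (lsort L)).

(* A coordinate function or a constant from C; indexing by the sort avoids casts. *)
Inductive cterm C G : forall s, (env M G -> M s) -> Prop :=
| ct_var (i : idx G) : cterm C (fun e : env M G => e i)
| ct_cst s (c : M s) : C (elt c) -> cterm C (fun _ : env M G => c).

Definition cmap C G D (f : env M G -> env M D) : Prop :=
  forall i, cterm C (fun e => f e i).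

(** The counterpart of [definable_over] for predicates up to pointwise equivalence, so that closure
    properties involve no equality of sets. *)
Definition Dp C G (P : env M G -> Prop) : Prop :=
  exists K (phi : formula (G (+) K)) (k : env M K),
    (forall j, C (elt (k j))) /\ forall e, sat phi (e +++ k) <-> P e.

Lemma Dp_definable_over C G (A : set (env M G)) : Dp C A <-> definable_over C A.
Proof.
split=> [[K [phi [k [Ck E]]]]|[[K phi k] Ck ->]].
  exists (PFormula phi k) => //; apply/seteqP; split=> e /=; by rewrite /psat /= E.
by exists K, phi, k; split.
Qed.

Lemma eq_Dp C G (P Q : env M G -> Prop) : (forall e, P e <-> Q e) -> Dp C Q -> Dp C P.
Proof.
move=> E [K [phi [k [Ck H]]]]; exists K, phi, k; split=> // e; by rewrite E H.
Qed.

Lemma Dp_mono C C' G (P : env M G -> Prop) : C `<=` C' -> Dp C P -> Dp C' P.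
Proof.
by move=> CC' [K [phi [k [Ck H]]]]; exists K, phi, k; split=> // j; apply: CC'.
Qed.

Lemma eq_cterm C G s (x y : env M G -> M s) : (forall e, x e = y e) -> cterm C y -> cterm C x.
Proof. by move=> xy; rewrite (_ : x = y) //; apply: fext. Qed.

Lemma cterm_comp C G D s (x : env M D -> M s) (f : env M G -> env M D) :
  cterm C x -> cmap C f -> cterm C (fun e => x (f e)).
Proof. by move=> [i|s' c Cc] hf; [exact: hf|exact: ct_cst]. Qed.

Lemma cterm_normal C G s (x : env M G -> M s) : cterm C x ->
  exists K (k : env M K), (forall j, C (elt (k j))) /\
    exists t : term (G (+) K) s, forall e, x e = eval (e +++ k) t.
Proof.
case=> [i|s' c Cc].
  exists Defs.Nil, (@empty_env _ M); split=> [[]|]; by exists (@Var L (G (+) Defs.Nil) (inl i)).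
exists (single s'), (env1 c); split=> //.
by exists (@Var L (G (+) single s') (inr ord0)).
Qed.

Definition weaken_l G K K' s (t : term (G (+) K) s) : term (G (+) (K (+) K')) s :=
  tsubst (fun i : idx (G (+) K) =>
      match i return term (G (+) (K (+) K')) (@sort_of _ (G (+) K) i) with
    | inl x => @Var L (G (+) (K (+) K')) (inl x)
    | inr x => @Var L (G (+) (K (+) K')) (inr (inl x)) end) t.

Definition weaken_r G K K' s (t : term (G (+) K') s) : term (G (+) (K (+) K')) s :=
  tsubst (fun i : idx (G (+) K') =>
      match i return term (G (+) (K (+) K')) (@sort_of _ (G (+) K') i) with
    | inl x => @Var L (G (+) (K (+) K')) (inl x)
    | inr x => @Var L (G (+) (K (+) K')) (inr (inr x)) end) t.

Lemma eval_weaken_l G K K' s (t : term (G (+) K) s) (e : env M G) (k : env M K) (k' : env M K') :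
  eval (e +++ (k +++ k')) (weaken_l K' t) = eval (e +++ k) t.
Proof.
rewrite /weaken_l eval_tsubst; congr (eval _ t).
by apply: fext => -[].
Qed.

Lemma eval_weaken_r G K K' s (t : term (G (+) K') s) (e : env M G) (k : env M K) (k' : env M K') :
  eval (e +++ (k +++ k')) (weaken_r K t) = eval (e +++ k') t.
Proof.
rewrite /weaken_r eval_tsubst; congr (eval _ t).
by apply: fext => -[].
Qed.

(** The constants used by different coordinates sit in different contexts. These are concatenated
    into one, in the [Tup] case one coordinate at a time, so that a single formula can carry them
    all. *)
Lemma cmap_normal C G D (f : env M G -> env M D) : cmap C f ->
  exists K (k : env M K), (forall j, C (elt (k j))) /\
    forall i : idx D, exists t : term (G (+) K) (sort_of i), forall e, f e i = eval (e +++ k) t.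
Proof.
elim: D f => [|n s|D1 IH1 D2 IH2] f hf.
- by exists Defs.Nil, (@empty_env _ M); split=> -[].
- suff h m : exists K (k : env M K), (forall j, C (elt (k j))) /\
    forall i : 'I_n, i < m -> exists t : term (G (+) K) (s i),
      forall e, f e i = eval (e +++ k) t.
    have [K [k [Ck H]]] := h n; exists K, k; split=> // i; exact: H.
  elim: m => [|m [K [k [Ck H]]]]; first by exists Defs.Nil, (@empty_env _ M); split=> -[].
  case: (ltnP m n) => [mn|nm]; last first.
    exists K, k; split=> // i im; apply: H; exact: leq_trans (ltn_ord i) nm.
  have [K' [k' [Ck' [t Ht]]]] := cterm_normal (hf (Ordinal mn)).
  exists (K (+) K'), (k +++ k'); split=> [[j|j]|i]; [exact: Ck|exact: Ck'|].
  rewrite ltnS leq_eqVlt => /orP[/eqP im|im].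
    have -> : i = Ordinal mn by apply/val_inj.
    by exists (weaken_r K t) => e; rewrite Ht eval_weaken_r.
  have [t' Ht'] := H i im; by exists (weaken_l K' t') => e; rewrite Ht' eval_weaken_l.
- have [K1 [k1 [C1 H1]]] := IH1 (fun e i => f e (inl i)) (fun i => hf (inl i)).
  have [K2 [k2 [C2 H2]]] := IH2 (fun e i => f e (inr i)) (fun i => hf (inr i)).
  exists (K1 (+) K2), (k1 +++ k2); split=> [[j|j]|[i|i]]; [exact: C1|exact: C2| |].
    have [t Ht] := H1 i; by exists (weaken_l K2 t) => e; rewrite Ht eval_weaken_l.
  have [t Ht] := H2 i; by exists (weaken_r K1 t) => e; rewrite Ht eval_weaken_r.
Qed.

Lemma Dp_sat C G D (phi : formula D) (f : env M G -> env M D) :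
  cmap C f -> Dp C (fun e => sat phi (f e)).
Proof.
move=> /cmap_normal[K [k [Ck]]] /(_ _)/cid-/all_sig[t Ht].
exists K, (fsubst phi t), k; split=> // e; rewrite sat_fsubst.
suff -> : f e = (fun i => eval (e +++ k) (t i)) by [].
by apply: fext => i.
Qed.

Lemma cmap_cat C G D K (f : env M G -> env M D) (g : env M G -> env M K) :
  cmap C f -> cmap C g -> cmap C (fun e => f e +++ g e).
Proof. by move=> hf hg [i|i]; [exact: hf|exact: hg]. Qed.

Lemma cmap_cst C G D (k : env M D) : (forall j, C (elt (k j))) -> cmap C (fun _ : env M G => k).
Proof. by move=> h i; apply: ct_cst. Qed.

Lemma cmap_id C G : cmap C (fun e : env M G => e).
Proof. by move=> i; apply: ct_var. Qed.

Lemma cmap_comp C G D K (f : env M G -> env M D) (g : env M D -> env M K) :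
  cmap C g -> cmap C f -> cmap C (fun e => g (f e)).
Proof. by move=> hg hf i; exact: (cterm_comp (hg i) hf). Qed.

Lemma Dp_comp C G D (P : env M D -> Prop) (f : env M G -> env M D) :
  Dp C P -> cmap C f -> Dp C (fun e => P (f e)).
Proof.
move=> [K [phi [k [Ck H]]]] hf.
apply: (@eq_Dp _ _ _ (fun e => sat phi (f e +++ k))) => [e|]; first by rewrite H.
by apply: Dp_sat; apply: cmap_cat => //; apply: cmap_cst.
Qed.

Definition fstE G K (e : env M (G (+) K)) : env M G := fun i => e (inl i).
Definition sndE G K (e : env M (G (+) K)) : env M K := fun i => e (inr i).

Lemma cat_fst_snd G K (e : env M (G (+) K)) : fstE e +++ sndE e = e.
Proof. by apply: fext => -[]. Qed.

Lemma cmap_fst C G D K (f : env M G -> env M (D (+) K)) : cmap C f -> cmap C (fun e => fstE (f e)).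
Proof. by move=> h i; exact: (h (inl i)). Qed.

Lemma cmap_snd C G D K (f : env M G -> env M (D (+) K)) : cmap C f -> cmap C (fun e => sndE (f e)).
Proof. by move=> h i; exact: (h (inr i)). Qed.

Lemma Dp_imp C G (P Q : env M G -> Prop) : Dp C P -> Dp C Q -> Dp C (fun e => P e -> Q e).
Proof.
move=> [K [phi [k [Ck H]]]] [K' [phi' [k' [Ck' H']]]].
(* The variables of G are duplicated, so that each formula keeps its own copy next to its own
   parameters. *)
pose f (e : env M G) := (e +++ k) +++ (e +++ k').
pose l := fsubst phi (fun i => @Var L ((G (+) K) (+) (G (+) K')) (inl i)).
pose r := fsubst phi' (fun i => @Var L ((G (+) K) (+) (G (+) K')) (inr i)).
apply: (@eq_Dp _ _ _ (fun e => sat (Imp l r) (f e))) => [e|].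
  by rewrite /= /l /r !sat_fsubst /= -H -H'.
by apply: Dp_sat; apply: cmap_cat; apply: cmap_cat; (exact: cmap_id || exact: cmap_cst).
Qed.

Lemma Dp_prop C G (P : Prop) : Dp C (fun _ : env M G => P).
Proof.
have F : Dp C (fun _ : env M G => False).
  by exists Defs.Nil, (Fls _), (@empty_env _ M); split=> [[]|].
have [p|np] := pselect P; last exact: eq_Dp F.
by apply: eq_Dp (Dp_imp F F).
Qed.

Lemma Dp_not C G (P : env M G -> Prop) : Dp C P -> Dp C (fun e => ~ P e).
Proof. by move=> h; apply: Dp_imp => //; exact: Dp_prop. Qed.

Lemma Dp_and C G (P Q : env M G -> Prop) : Dp C P -> Dp C Q -> Dp C (fun e => P e /\ Q e).
Proof.
move=> hP hQ; apply: eq_Dp (Dp_not (Dp_imp hP (Dp_not hQ))) => e.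
have [|] := pselect (P e); have [|] := pselect (Q e); tauto.
Qed.

Lemma Dp_or C G (P Q : env M G -> Prop) : Dp C P -> Dp C Q -> Dp C (fun e => P e \/ Q e).
Proof.
move=> hP hQ; apply: eq_Dp (Dp_imp (Dp_not hP) hQ) => e.
have [|] := pselect (P e); tauto.
Qed.

Lemma Dp_iff C G (P Q : env M G -> Prop) : Dp C P -> Dp C Q -> Dp C (fun e => P e <-> Q e).
Proof. by move=> hP hQ; apply: Dp_and; apply: Dp_imp. Qed.

Lemma Dp_eq C G s (x y : env M G -> M s) : cterm C x -> cterm C y -> Dp C (fun e => x e = y e).
Proof.
move=> hx hy.
pose E : formula (single s (+) single s) :=
  @Eq L _ s (@Var L (single s (+) single s) (inl ord0)) (@Var L (single s (+) single s) (inr ord0)).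
have := @Dp_sat C G _ E (fun e => env1 (x e) +++ env1 (y e)); apply.
by apply: cmap_cat => i.
Qed.

Lemma Dp_all1 C G s (P : env M (G (+) single s) -> Prop) :
  Dp C P -> Dp C (fun e => forall a : M s, P (e +++ env1 a)).
Proof.
move=> [K [phi [k [Ck H]]]].
(* [All] binds the last variable, whereas the parameters stand last in phi; the substitution
   exchanges the two. *)
pose sg : forall i : idx ((G (+) single s) (+) K), term ((G (+) K) (+) single s) (sort_of i) :=
  fun i => match i with
  | inl (inl x) => @Var L ((G (+) K) (+) single s) (inl (inl x))
  | inl (inr x) => @Var L ((G (+) K) (+) single s) (inr x)
  | inr x => @Var L ((G (+) K) (+) single s) (inl (inr x))
  end.
exists K, (All (fsubst phi sg)), k; split=> // e.
have E a : (fun i => eval (e +++ k +++ env1 a) (sg i)) = e +++ env1 a +++ k.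
  by apply: fext => -[[]|].
split=> /= h a; first by rewrite -H -E -sat_fsubst; exact: h.
by rewrite sat_fsubst E H; exact: h.
Qed.

(** The dependent form is used because the variables of a [Tup] may have different sorts. *)
Definition cons_dep n (T : 'I_n.+1 -> Type) (x : T ord0) (y : forall j, T (lift ord0 j)) i : T i :=
  match unliftP ord0 i with
  | UnliftSome j E => eq_rect_r T (y j) E
  | UnliftNone E => eq_rect_r T x E
  end.

Lemma cons_dep0 n (T : 'I_n.+1 -> Type) (x : T ord0) y : @cons_dep n T x y ord0 = x.
Proof.
rewrite /cons_dep; case: unliftP => [j E|E]; first by have := congr1 val E.
by rewrite (Prop_irrelevance E erefl).
Qed.

Lemma cons_depS n (T : 'I_n.+1 -> Type) (x : T ord0) y j : @cons_dep n T x y (lift ord0 j) = y j.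
Proof.
rewrite /cons_dep; case: unliftP => [j' E|E]; last by have := congr1 val E.
have jj : j = j' by apply: lift_inj E.
by subst j'; rewrite (Prop_irrelevance E erefl).
Qed.

(** [All] binds one variable, so a block of quantifiers is handled by induction on the structure of
    its context. *)
Lemma Dp_all_cat C G K (P : env M (G (+) K) -> Prop) :
  Dp C P -> Dp C (fun e => forall b : env M K, P (e +++ b)).
Proof.
elim: K G P => [|n s|K1 IH1 K2 IH2] G P hP.
- apply: (@eq_Dp _ _ _ (fun e => P (e +++ @empty_env _ M))) => [e|].
    split=> // h b; suff -> : b = @empty_env _ M by [].
    by apply: fext => -[].
  by apply: Dp_comp hP _; apply: cmap_cat; [exact: cmap_id|move=> []].
- elim: n s G P hP => [|n IH] s G P hP.
    pose b0 : env M (@Tup _ 0 s) := fun i => False_rect _ (notF (ltn_ord i)).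
    apply: (@eq_Dp _ _ _ (fun e => P (e +++ b0))) => [e|].
      split=> // h b; suff -> : b = b0 by [].
      by apply: fext => -[].
    by apply: Dp_comp hP _; apply: cmap_cat; [exact: cmap_id|move=> []].
  (* The context is regrouped so that the first variable of the tuple is bound separately from the
     remaining n. *)
  pose G' := (G (+) single (s ord0)) (+) @Tup _ n (fun j => s (lift ord0 j)).
  pose Q (e : env M G') :=
    P (fstE (fstE e) +++ (@cons_dep n (fun i =>
        M (s i)) (sndE (fstE e) ord0) (sndE e) : env M (Tup s))).
  have hQ : Dp C Q.
    apply: Dp_comp hP _; apply: cmap_cat; first by do 2 apply cmap_fst; apply cmap_id.
    move=> i; case: (unliftP ord0 i) => [j ->|->].
      apply: (@eq_cterm _ G' (s (lift ord0 j)) _ (fun e => e (inr j))); last first.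
        exact: (@ct_var C G' (inr j)).
      by move=> e; rewrite cons_depS.
    apply: (@eq_cterm _ G' (s ord0) _ (fun e => e (inl (inr ord0)))); last first.
      exact: (@ct_var C G' (inl (inr ord0))).
    by move=> e; rewrite cons_dep0.
  apply: eq_Dp (Dp_all1 (IH _ _ _ hQ)) => e; split=> h.
    by move=> a b; rewrite /Q; apply: h.
  move=> b; have := h (b ord0) (fun j => b (lift ord0 j)); rewrite /Q /=.
  congr (P (_ +++ _)); apply: fext => i.
  by case: (unliftP ord0 i) => [j ->|->]; rewrite ?cons_depS ?cons_dep0.
- pose Q (e : env M ((G (+) K1) (+) K2)) :=
    P (fstE (fstE e) +++ (sndE (fstE e) +++ sndE e)).
  have hQ : Dp C Q.
    apply: Dp_comp hP _.
    apply: cmap_cat; first by do 2 apply cmap_fst; apply cmap_id.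
    by apply cmap_cat; [apply cmap_snd; apply cmap_fst|apply cmap_snd]; apply cmap_id.
  apply: eq_Dp (IH1 _ _ (IH2 _ _ hQ)) => e; split=> h.
    by move=> b1 b2; exact: h.
  by move=> b; have := h (fstE b) (sndE b);
      rewrite /Q /= /fstE /sndE /= -/(fstE b) -/(sndE b) cat_fst_snd.
Qed.

Lemma Dp_all C G K (P : env M G -> env M K -> Prop) :
  Dp C (fun e : env M (G (+) K) => P (fstE e) (sndE e)) ->
  Dp C (fun e => forall b : env M K, P e b).
Proof. exact: Dp_all_cat. Qed.

Lemma Dp_ex C G K (P : env M G -> env M K -> Prop) :
  Dp C (fun e : env M (G (+) K) => P (fstE e) (sndE e)) ->
  Dp C (fun e => exists b : env M K, P e b).
Proof.
move=> /Dp_not h; apply: eq_Dp (Dp_not (Dp_all (P := fun e b => ~ P e b) h)) => e.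
split=> [[b Pb] /(_ b)//|h']; apply: contrapT => /forallNP; exact.
Qed.

Lemma Dp_allE C G s (P : env M G -> M s -> Prop) :
  Dp C (fun e : env M (G (+) single s) => P (fstE e) (sndE e ord0)) ->
  Dp C (fun e => forall b : M s, P e b).
Proof. exact: Dp_all1. Qed.

Lemma Dp_exE C G s (P : env M G -> M s -> Prop) :
  Dp C (fun e : env M (G (+) single s) => P (fstE e) (sndE e ord0)) ->
  Dp C (fun e => exists b : M s, P e b).
Proof.
move=> /Dp_not h; apply: eq_Dp (Dp_not (Dp_allE (P := fun e b => ~ P e b) h)) => e.
split=> [[b Pb] /(_ b)//|h']; apply: contrapT => /forallNP; exact.
Qed.

Lemma Dp_allF (T : finType) C G (P : T -> env M G -> Prop) :
  (forall i, Dp C (P i)) -> Dp C (fun e => forall i : T, P i e).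
Proof.
move=> h; apply: (@eq_Dp _ _ _ (fun e => forall i, i \in enum T -> P i e)).
  by move=> e; split=> // H i; apply: H; rewrite mem_enum.
elim: (enum T) => [|a s IH]; first by apply: eq_Dp (Dp_prop C G True).
apply: eq_Dp (Dp_and (h a) IH) => e; split=> [H|[Ha Hs] i].
  by split=> [|i si]; apply: H; rewrite inE ?eqxx ?si ?orbT.
by rewrite inE => /orP[/eqP->//|/Hs].
Qed.

Lemma Dp_exF (T : finType) C G (P : T -> env M G -> Prop) :
  (forall i, Dp C (P i)) -> Dp C (fun e => exists i : T, P i e).
Proof.
move=> h; apply: eq_Dp (Dp_not (Dp_allF (fun i => Dp_not (h i)))) => e.
split=> [[b Pb] /(_ b)//|h']; apply: contrapT => /forallNP; exact.
Qed.

Lemma cterm_pow C G n s (f : env M G -> env M (power s n)) (i : 'I_n) :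
  cmap C f -> cterm C (fun e => f e i : M s).
Proof. by move=> h; exact: (h i). Qed.

Lemma cterm_cst C G s (a : M s) : C (elt a) -> cterm C (fun _ : env M G => a).
Proof. exact: ct_cst. Qed.

Lemma cmap_env1 C G s (x : env M G -> M s) : cterm C x -> cmap C (fun e => env1 (x e)).
Proof. by move=> h i. Qed.

Lemma cmap_pow C G n s (x : env M G -> 'I_n -> M s) :
  (forall i, cterm C (fun e => x e i)) ->
  cmap C (fun e => (x e : env M (power s n))).
Proof. by move=> h i; exact: h. Qed.

End Definability.

Definition cons_fun (T : Type) n (x : T) (y : 'I_n -> T) : 'I_n.+1 -> T :=
  @cons_dep n (fun=> T) x y.

Lemma cons_fun0 T n (x : T) (y : 'I_n -> T) : cons_fun x y ord0 = x.
Proof. exact: cons_dep0. Qed.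

Lemma cons_funS T n (x : T) (y : 'I_n -> T) j : cons_fun x y (lift ord0 j) = y j.
Proof. exact: cons_depS. Qed.

Lemma cons_fun_eta T n (u : 'I_n.+1 -> T) : cons_fun (u ord0) (fun j => u (lift ord0 j)) = u.
Proof.
by apply: funext => i; case: (unliftP ord0 i) => [j ->|->]; rewrite ?cons_funS ?cons_fun0.
Qed.

Lemma cmap_cons (L : language) (M : structure L) (C : set (element M)) G n s
    (x : env M G -> M s) (y : env M G -> env M (power s n)) :
  cterm C x -> cmap C y ->
  cmap C (fun e => (cons_fun (x e) (y e) : env M (power s n.+1))).
Proof.
move=> hx hy; apply: cmap_pow => i; case: (unliftP ord0 i) => [j ->|->].
  apply: (@eq_cterm _ _ C G s _ (fun e => y e j)); first by move=> e; rewrite cons_funS.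
  exact: (hy j).
by apply: eq_cterm hx => e; rewrite cons_fun0.
Qed.

(** Follows the syntax of a map to show that it is made of coordinates and constants. *)
Ltac cm :=
  lazymatch goal with
  | |- cmap _ (fun e => e) => apply cmap_id
  | |- cmap _ (@fstE _ _ _ _) => apply (cmap_fst (@cmap_id _ _ _ _))
  | |- cmap _ (@sndE _ _ _ _) => apply (cmap_snd (@cmap_id _ _ _ _))
  | |- cmap _ (fun e => fstE _) => apply cmap_fst; cm
  | |- cmap _ (fun e => sndE _) => apply cmap_snd; cm
  | |- cmap _ (fun e => cat_env _ _) => apply cmap_cat; cm
  | |- cmap _ (fun e => cons_fun _ _) => apply cmap_cons; cm
  | |- cmap _ (fun e => env1 _) => apply cmap_env1; cm
  | |- cmap _ (fun _ => ?k) => first [by apply cmap_cst | idtac]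
  | |- cterm _ (fun _ => ?k) => first [by apply cterm_cst | idtac]
  | |- cterm ?C (fun e => @sndE ?L ?M ?D ?K (@?f e) ?i) =>
      refine ((_ : cmap C (fun e => @sndE L M D K (f e))) i); cm
  | |- cterm ?C (fun e => @fstE ?L ?M ?D ?K (@?f e) ?i) =>
      refine ((_ : cmap C (fun e => @fstE L M D K (f e))) i); cm
  | |- cterm _ _ => first [apply cterm_pow; cm | idtac]
  | |- cmap _ (fun e => fun i => _) => apply cmap_pow; let i := fresh "i" in intro i; cm
  | |- _ => idtac
  end.

(** * Counting by injections from finite ordinals *)

Section Counting.
Variable T : Type.
Implicit Types P Q : T -> Prop.

(** In this form a bound on the number of solutions of a formula is itself first-order, see
    [Dp_at_least]. *)
Definition at_least n P := exists2 u : 'I_n -> T, injective u & forall i, P (u i).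

Lemma at_least_sub n P Q : (forall x, P x -> Q x) -> at_least n P -> at_least n Q.
Proof. by move=> PQ [u ui uP]; exists u => // i; exact: PQ. Qed.

Lemma at_least_le m n P : m <= n -> at_least n P -> at_least m P.
Proof.
move=> mn [u ui uP]; exists (fun i => u (widen_ord mn i)) => // i j /ui /(congr1 val) /= ij.
exact: val_inj.
Qed.

Lemma at_least0 P : at_least 0 P.
Proof. by exists (fun i : 'I_0 => False_rect T (notF (ltn_ord i))) => -[]. Qed.

Lemma at_leastS n P x : P x -> at_least n (fun y => P y /\ y <> x) -> at_least n.+1 P.
Proof.
move=> Px [u ui uP]; exists (cons_fun x u).
  move=> i j; case: (unliftP ord0 i) => [i' ->|->]; case: (unliftP ord0 j) => [j' ->|->];
    rewrite ?cons_funS ?cons_fun0 //.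
  - by move=> /ui ->.
  - by move=> E; have [] := uP i'.
  - by move=> E; have [] := uP j'; rewrite E.
move=> i; case: (unliftP ord0 i) => [i' ->|->]; rewrite ?cons_funS ?cons_fun0 //.
by have [] := uP i'.
Qed.

Lemma infinite_at_least n P : infinite_set [set x | P x] -> at_least n P.
Proof.
elim: n P => [|n IH] P iP; first exact: at_least0.
have [x /= Px] := infinite_setN0 iP.
apply: (at_leastS Px); apply: IH.
exact: infinite_setD iP (finite_set1 x).
Qed.

Lemma finite_not_at_least P : finite_set [set x | P x] -> exists n, ~ at_least n P.
Proof.
move=> /(@finite_seqP {classic T})[s sE]; exists (size s).+1 => -[u ui uP].
pose u' : 'I_(size s).+1 -> {classic T} := u.
have us : uniq [seq u' i | i <- enum 'I_(size s).+1].
  by rewrite map_inj_uniq ?enum_uniq.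
suff /(uniq_leq_size us) : {subset [seq u' i | i <- enum 'I_(size s).+1] <= s}.
  by rewrite size_map size_enum_ord ltnn.
move=> _ /mapP[i _ ->]; have : [set x | P x] (u i) by exact: uP.
by rewrite sE.
Qed.

Lemma not_at_least_finite n P : ~ at_least n P -> finite_set [set x | P x].
Proof. by move=> nP; apply: contrapT => iP; exact: nP (infinite_at_least _ iP). Qed.

(** Pigeonhole; [~ at_least n.+1] is the way a bound by n elements is expressed. *)
Lemma not_at_leastU m n P Q : ~ at_least m.+1 P -> ~ at_least n.+1 Q ->
  ~ at_least (m + n).+1 (fun x => P x \/ Q x).
Proof.
move=> nP nQ [u ui uPQ].
pose A := [set i | `[< P (u i) >]]%SET.
pose B := [set i | `[< Q (u i) >]]%SET.
have AB : #|[set: 'I_(m + n).+1]%SET| <= #|A| + #|B|.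
  rewrite -cardsUI; apply: leq_trans (leq_addr _ _).
  apply: subset_leq_card; apply/fintype.subsetP => i _; rewrite !inE.
  by case: (uPQ i) => h; apply/orP; [left|right]; apply/asboolP.
have hA : #|A| <= m.
  rewrite leqNgt; apply/negP => mA; apply: nP; apply: (at_least_le mA).
  exists (fun i => u (enum_val i)); first by move=> i j /ui /enum_val_inj.
  by move=> i; have := enum_valP i; rewrite !inE.
have hB : #|B| <= n.
  rewrite leqNgt; apply/negP => mA; apply: nQ; apply: (at_least_le mA).
  exists (fun i => u (enum_val i)); first by move=> i j /ui /enum_val_inj.
  by move=> i; have := enum_valP i; rewrite !inE.
have := leq_trans AB (leq_add hA hB); by rewrite cardsT card_ord ltnn.
Qed.

End Counting.

(** Hilbert's hotel: a sequence g in the infinite type U is shifted by one, which frees [g 0] for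
    the new element. *)
Lemma card_le_setU1 T U (A : set T) (a : T) :
  infinite_set [set: U] -> (A #<= [set: U])%card -> (A `|` [set a] #<= [set: U])%card.
Proof.
elim/Ppointed: U => U; first by rewrite emptyE => /(_ (finite_set0 _)).
move=> /infiniteP/pcard_injP[g gi] /pcard_injP[f fi]; apply/pcard_injP.
have {}gi m n : g m = g n -> m = n by move=> /gi; apply; rewrite inE.
pose h u := if pselect (exists n, u = g n) is left e then g (projT1 (cid e)).+1 else u.
have hg n : h (g n) = g n.+1.
  rewrite /h; case: pselect => [e|[]]; last by exists n.
  by case: cid => m /= /gi ->.
have hN u : ~ (exists n, u = g n) -> h u = u by rewrite /h; case: pselect.
have h0 u : h u <> g 0.
  have [[n ->]|nu] := pselect (exists n, u = g n); first by rewrite hg => /gi.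
  by rewrite hN // => E; apply: nu; exists 0.
have hi u v : h u = h v -> u = v.
  have [[n ->]|nu] := pselect (exists n, u = g n);
    have [[m ->]|nv] := pselect (exists n, v = g n); rewrite ?hg ?hN //.
  - by move=> /gi[->].
  - by move=> E; case: nv; exists n.+1.
  - by move=> E; case: nu; exists m.+1.
exists (fun x => if pselect (A x) is left _ then h (f x) else g 0).
move=> x y; rewrite !inE => hx hy; case: pselect => Ax; case: pselect => Ay.
- by move=> /hi /fi; apply; rewrite inE.
- by move=> /h0.
- by move=> /esym /h0.
- by case: hx => // ->; case: hy => // ->.
Qed.

Lemma card_le_setU_finite T U (A F : set T) : infinite_set [set: U] -> finite_set F ->
  (A #<= [set: U])%card -> (A `|` F #<= [set: U])%card.
Proof.
move=> iU /(@finite_seqP {classic T})[s ->]; elim: s A => [|a s IH] A AU.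
  by apply: card_le_trans AU; apply: subset_card_le => x /= [].
apply: card_le_trans (IH _ (card_le_setU1 a iU AU)).
apply: subset_card_le => x /=.
by case=> [?|]; [left; left|rewrite inE => /orP[/eqP->|?]; [left; right|right]].
Qed.

(** * Small parameter sets, saturation and types *)

Section Types.
Variables (L : language) (M : structure L).
Implicit Types (C D F : set (element M)) (G K : ctx (lsort L)).

Fixpoint imp_depth G (phi : formula G) : nat :=
  if phi is Imp p q then (imp_depth q).+1 else 0.

(** Iterated implications between falsities are told apart by [imp_depth]. *)
Lemma infinite_any_formula : infinite_set [set: any_formula L].
Proof.
pose s0 (i : 'I_0) : lsort L := False_rect _ (notF (ltn_ord i)).
pose f n : formula (@Tup _ 0 s0) := iter n (Imp (Fls _)) (Fls _).
have fn n : imp_depth (f n) = n by elim: n => //= n ->.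
pose g n : any_formula L := existT _ 0 (existT _ s0 (f n)).
move=> /finite_not_at_least[n]; apply; exists (fun i => g (val i)) => // i j.
by move=> /(congr1 (fun x : any_formula L => imp_depth (projT2 (projT2 x)))) /=; rewrite !fn =>
    /val_inj.
Qed.

Lemma small_setU C F : small C -> finite_set F -> small (C `|` F).
Proof. by move=> sC fF; apply: card_le_setU_finite => //; exact: infinite_any_formula. Qed.

Lemma small_sub C D : C `<=` D -> small D -> small C.
Proof. by move=> CD; apply: card_le_trans; exact: subset_card_le. Qed.

Lemma small_finite F : finite_set F -> small F.
Proof.
move=> fF; apply: small_sub (small_setU (C := set0) _ fF); first by move=> x; right.
exact: card_ge0.
Qed.

Definition elts_on G (u : env M G) (J : idx G -> Prop) : set (element M) :=
  [set p | exists2 i, J i & p = elt (u i)].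

Definition elts G (u : env M G) := elts_on u setT.

Lemma elts_on_sub G (u : env M G) J : elts_on u J `<=` elts u.
Proof. by move=> p [i _ ->]; exists i. Qed.

Lemma finite_elts G (u : env M G) : finite_set (elts u).
Proof.
elim: G u => [|n s|G1 IH1 G2 IH2] u.
- by apply: sub_finite_set (finite_set0 _) => p [].
- apply: sub_finite_set (finite_image (fun i : 'I_n => elt (u i)) (@finite_finset _ setT)).
  by move=> p [i _ ->]; exists i.
- have := IH1 (fstE u); have := IH2 (sndE u) => f2 f1.
  apply: (@sub_finite_set _ _ (elts (fstE u) `|` elts (sndE u))); last by rewrite finite_setU.
  by move=> p [[i|i] _ ->]; [left|right]; exists i.
Qed.

Lemma finite_elts_on G (u : env M G) J : finite_set (elts_on u J).
Proof. exact: sub_finite_set (@elts_on_sub _ _ _) (finite_elts u). Qed.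

Lemma Dp_small G (P : env M G -> Prop) : Dp setT P -> exists2 C, small C & Dp C P.
Proof.
move=> [K [phi [k [_ H]]]]; exists (elts k); first exact/small_finite/finite_elts.
by exists K, phi, k; split=> // j; exists j.
Qed.

(* Elements of C u {u_j : j in J} used as parameters can be abstracted into variables. *)
Lemma Dp_split C G K (u : env M K) (J : idx K -> Prop) (P : env M G -> Prop) :
  Dp (C `|` elts_on u J) P ->
  exists R : env M G -> env M K -> Prop,
   [/\ Dp C (fun e : env M (G (+) K) => R (fstE e) (sndE e)),
       forall e, R e u <-> P e
     & forall u1 u2, (forall j, J j -> u1 j = u2 j) -> forall e, R e u1 -> R e u2].
Proof.
move=> [K' [phi [k [Ck H]]]].
(* Each parameter becomes either a constant from C or the projection to a coordinate in J. *)
have /(_ _)/cid-/all_sig[x hx] j : exists x : env M K -> M (sort_of j),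
    [/\ cterm C x, x u = k j &
      forall u1 u2, (forall j, J j -> u1 j = u2 j) -> x u1 = x u2].
  case: (Ck j) => [Cj|[i Ji E]].
    by exists (fun=> k j); split=> //; exact: ct_cst.
  move: (k j) E; move: (sort_of j) => s c; rewrite /elt => E.
  have Es : s = sort_of i by exact: (congr1 (@projT1 _ _) E).
  subst s; have -> : c = u i.
    by have := projT2_eq E; rewrite (Prop_irrelevance (projT1_eq E) erefl).
  exists (fun u => u i); split=> // [|u1 u2 h]; [exact: ct_var|exact: h].
exists (fun e u' => sat phi (e +++ (fun j => x j u'))); split=> [|e|u1 u2 E e].
- apply: (@Dp_sat _ _ C _ _ phi (fun e => fstE e +++ (fun j => x j (sndE e)))).
  apply: cmap_cat => [|j]; first by cm.
  have [h _ _] := hx j; apply: (cterm_comp h (f := fun e => sndE e)); cm.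
- rewrite -H; suff -> : (fun j => x j u) = k by [].
  by apply: fext => j; have [] := hx j.
- suff -> : (fun j => x j u1) = (fun j => x j u2) by [].
  by apply: fext => j; have [_ _] := hx j; apply.
Qed.

(** Saturation for downward directed families of definable sets: finitely many members contain a
    common nonempty member, so the formulas defining members of S form a finitely satisfiable
    type. *)
Lemma saturation C G (S : set (env M G) -> Prop) :
  saturated M -> small C ->
  (forall A, S A -> Dp C A) -> (exists A, S A) -> (forall A, S A -> A !=set0) ->
  (forall A B, S A -> S B -> exists2 E, S E & E `<=` A `&` B) ->
  exists a, forall A, S A -> A a.
Proof.
move=> sat sC SD [A0 SA0] Sne Sdir.
pose p : set (pformula M G) := [set phi | with_params C phi /\ S [set a | psat phi a]].
have [||a ha] := sat C G p sC.
- by move=> phi [].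
- move=> q /(@finite_seqP {classic _})[s ->] sp.
  suff [A SA As] : exists2 A, S A & forall a, A a -> forall phi : {classic _}, phi \in s ->
      psat phi a.
    by have [a Aa] := Sne _ SA; exists a => phi phis; exact: As Aa _ phis.
  elim: s sp => [|phi s IH] sp; first by exists A0.
  have [|A SA hA] := IH; first by move=> x xs; apply: sp; rewrite /= inE xs orbT.
  have [|_ Sphi] := sp phi; first by rewrite /= inE eqxx.
  have [E SE EA] := Sdir _ _ SA Sphi; exists E => // a /EA[Aa pa] psi.
  by rewrite inE => /orP[/eqP->//|]; exact: hA.
exists a => A SA; have /Dp_definable_over[phi Cphi AE] := SD _ SA.
by rewrite AE; apply: ha; split=> //; rewrite -AE.
Qed.

(** Equality of types over C. One implication suffices, by passing to complements, see
    [eqtp_sym]. *)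
Definition eqtp C G (t t' : env M G) := forall A : env M G -> Prop, Dp C A -> A t -> A t'.

Lemma eqtp_sym C G (t t' : env M G) : eqtp C t t' -> eqtp C t' t.
Proof. by move=> h A dA At'; apply: contrapT => nA; exact: (h _ (Dp_not dA) nA). Qed.

Lemma eqtp_trans C G (t1 t2 t3 : env M G) : eqtp C t1 t2 -> eqtp C t2 t3 -> eqtp C t1 t3.
Proof. by move=> h h' A dA /(h _ dA); exact: h'. Qed.

Lemma eqtp_mono C C' G (t t' : env M G) : C `<=` C' -> eqtp C' t t' -> eqtp C t t'.
Proof. by move=> CC h A /(Dp_mono CC); exact: h. Qed.

End Types.

(* Descends through connectives and quantifiers, leaving the atoms other than equations. *)
Ltac dp :=
  lazymatch goal with
  | |- Dp _ (fun e => ~ _) => apply Dp_not; dp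
  | |- Dp _ (fun e => _ /\ _) => apply Dp_and; dp
  | |- Dp _ (fun e => _ \/ _) => apply Dp_or; dp
  | |- Dp _ (fun e => _ <-> _) => apply Dp_iff; dp
  | |- Dp _ (fun e => exists x : env _ _, _) => apply Dp_ex; dp
  | |- Dp _ (fun e => exists x : carrier _ _, _) => apply Dp_exE; dp
  | |- Dp _ (fun e => exists x : ordinal _, _) =>
      apply Dp_exF; let i := fresh "i" in intro i; dp
  | |- Dp _ (fun e => forall x : env _ _, _) => apply Dp_all; dp
  | |- Dp _ (fun e => forall x : carrier _ _, _) => apply Dp_allE; dp
  | |- Dp _ (fun e => forall x : ordinal _, _) =>
      apply Dp_allF; let i := fresh "i" in intro i; dp
  | |- Dp _ (fun e => _ = _ :> carrier _ _) => apply Dp_eq; cm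
  | |- Dp _ (fun _ => ?P) => apply Dp_prop
  | |- Dp _ (fun e => exists x : {ffun _}, _) =>
      apply Dp_exF; let i := fresh "i" in intro i; dp
  | |- Dp _ (fun e => forall x : {ffun _}, _) =>
      apply Dp_allF; let i := fresh "i" in intro i; dp
  | |- Dp _ (fun e => _ -> _) => apply Dp_imp; dp
  | |- _ => idtac
  end.

(** * Finiteness of minimal hitting sets *)

(* Among the hitting sets of minimal cardinality of a family of sets of size <= K,
   at most K ^ s elements occur. *)
Section HittingSets.
Variables (T I : Type) (E : I -> T -> Prop) (K : nat).
Hypothesis EK : forall i, ~ at_least K.+1 (E i).

Definition hits (Th : I -> Prop) s (v : 'I_s -> T) := forall i, Th i -> exists j, E i (v j).

Lemma finite_minimal_hitting s (Th : I -> Prop) :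
  (forall s' (v : 'I_s' -> T), s' < s -> ~ hits Th v) ->
  finite_set [set w | exists2 v : 'I_s -> T, hits Th v & exists j, v j = w].
Proof.
elim: s Th => [|s IH] Th smin.
  by apply: sub_finite_set (finite_set0 _) => w [v _ [[]]].
have [i0 Thi0] : exists i, Th i.
  apply: contrapT => /forallNP nTh.
  by apply: (smin 0 (fun j : 'I_0 => False_rect T (notF (ltn_ord j)))) => // i /nTh.
(* A hitting tuple has an entry f in [E i0], for which there are finitely many choices. The
   remaining entries form a minimal hitting tuple for the sets that do not contain f. *)
pose Thf f i := Th i /\ ~ E i f.
apply: (@sub_finite_set _ _ (\bigcup_(f in [set f | E i0 f])
  ([set f] `|` [set w | exists2 v : 'I_s -> T, hits (Thf f) v & exists j, v j = w]))).
  move=> w [v hv [j <-]]; have [j0 Ej0] := hv _ Thi0.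
  exists (v j0) => //; case: (unliftP j0 j) => [j' ->|->]; last by left.
  right; exists (fun k => v (lift j0 k)); last by exists j'.
  move=> i [Thi nE]; have [k Ek] := hv _ Thi.
  by case: (unliftP j0 k) Ek => [k' ->|->] Ek; [exists k'|case: nE].
apply: bigcup_finite; first exact: not_at_least_finite (@EK i0).
move=> f _; rewrite finite_setU; split; first exact: finite_set1.
apply: IH => s' v s's hv; apply: (smin s'.+1 (cons_fun f v)) => // i Thi.
have [Ef|nEf] := pselect (E i f); first by exists ord0; rewrite cons_fun0.
by have [//|j Ej] := hv i; exists (lift ord0 j); rewrite cons_funS.
Qed.

End HittingSets.

(** * Algebraic closure in the home sort *)

Section Acl.
Variables (L : language) (M : structure L).
Local Notation H := (M (home L)).
Local Notation h := (single (home L)).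
Implicit Types (C D F : set (element M)) (G K : ctx (lsort L)).

Lemma Dp_app2 C G K G' (R : env M G -> env M K -> Prop) (f : env M G' -> env M G)
    (g : env M G' -> env M K) :
  Dp C (fun e : env M (G (+) K) => R (fstE e) (sndE e)) -> cmap C f -> cmap C g ->
  Dp C (fun e => R (f e) (g e)).
Proof. by move=> hR hf hg; apply: (Dp_comp hR (cmap_cat hf hg)). Qed.

(** A definable family of subsets of the home sort with index in [env M G]; [def1] is the case of a
    single subset. *)
Definition def2 C G (A : env M G -> H -> Prop) :=
  Dp C (fun e : env M (G (+) h) => A (fstE e) (sndE e ord0)).

Definition def1 C (P : H -> Prop) := Dp C (fun e : env M h => P (e ord0)).

Lemma def2_app C G G' (A : env M G -> H -> Prop) (f : env M G' -> env M G) x :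
  def2 C A -> cmap C f -> cterm C x -> Dp C (fun e => A (f e) (x e)).
Proof.
move=> hA hf hx.
apply: (Dp_comp (f := fun e => f e +++ env1 (x e)) hA).
by apply: cmap_cat => //; apply: cmap_env1.
Qed.

Lemma def1_app C G' (A : H -> Prop) (x : env M G' -> H) :
  def1 C A -> cterm C x -> Dp C (fun e => A (x e)).
Proof.
move=> hA hx; apply: (Dp_comp (f := fun e => env1 (x e)) hA).
by apply: cmap_env1.
Qed.

Lemma def2_fiber C G (A : env M G -> H -> Prop) (u : env M G) :
  def2 C A -> def1 (C `|` elts u) (A u).
Proof.
move=> hA; apply: (@def2_app _ _ _ _ (fun=> u)).
- by apply: Dp_mono hA => p; left.
- by apply: cmap_cst => j; right; exists j.
- by cm.
Qed.

Lemma Dp_at_least C G (A : env M G -> H -> Prop) n : def2 C A -> Dp C (fun e => at_least n (A e)).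
Proof.
move=> hA; apply: (@eq_Dp _ _ _ _ _ (fun e => exists u : env M (power (home L) n),
   (forall i j : 'I_n, u i = u j :> H -> i = j) /\ forall i : 'I_n, A e (u i))).
  by move=> e; split=> [[u ui uA]|[u [ui uA]]]; exists u => //; move=> i j; exact: ui.
dp; apply: (def2_app hA); cm.
Qed.

Definition acl_home C (x : H) := exists P, [/\ def1 C P, finite_set [set y | P y] & P x].

Lemma acl_homeE C x : acl C (elt x) <-> acl_home C x.
Proof.
have e1 (e : env M h) : env1 (e ord0) = e by apply: fext => i; rewrite (ord1 i).
split=> [[phi [Cphi fphi px]]|[P [dP fP Px]]].
  exists (fun y => psat phi (env1 y)); split=> //.
  apply: (@eq_Dp _ _ _ _ _ (psat phi)) => [e|]; first by rewrite e1.
  by apply/Dp_definable_over; exists phi.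
have /Dp_definable_over[phi Cphi E] := dP.
have {}E y : P y <-> psat phi (env1 y).
  by have := congr1 (fun A : set (env M h) => A (env1 y)) E => /= ->.
exists phi; split=> //=; last exact/E.
by apply: sub_finite_set fP => y /E.
Qed.

Lemma acl_mono C D x : C `<=` D -> acl_home C x -> acl_home D x.
Proof. by move=> CD [P [dP fP Px]]; exists P; split=> //; exact: Dp_mono dP. Qed.

Lemma acl_self C x : C (elt x) -> acl_home C x.
Proof.
move=> Cx; exists (fun y => y = x); split=> //; last exact: finite_set1.
by rewrite /def1; dp.
Qed.

Lemma acl_fiber C G (u : env M G) (R : env M G -> H -> Prop) x n :
  def2 C R -> ~ at_least n (R u) -> R u x -> acl_home (C `|` elts u) x.
Proof.
by move=> dR bR Rx; exists (R u); split=> //; [exact: def2_fiber|exact: not_at_least_finite bR].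
Qed.

(** The bound on the number of solutions, at first valid for the tuple u only, is made part of the
    formula, so that it holds for every tuple. Bounded families of this kind are what the later
    compactness arguments range over. *)
Lemma acl_split C G (u : env M G) J x : acl_home (C `|` elts_on u J) x ->
  exists (R : env M G -> H -> Prop) n,
  [/\ def2 C R, forall u', ~ at_least n.+1 (R u'), R u x &
      forall u1 u2, (forall j, J j -> u1 j = u2 j) -> forall y, R u1 y -> R u2 y].
Proof.
move=> [P [dP fP Px]].
have [R [dR RP Rdep]] := Dp_split dP.
have {}fP : finite_set [set y | R (env1 y) u] by apply: sub_finite_set fP => y /= /RP.
have [n nR] := finite_not_at_least fP.
pose R1 u' y := R (env1 y) u'.
have dR1 : def2 C R1.
  by rewrite /def2 /R1; apply: (Dp_app2 dR); cm.
exists (fun u' y => R1 u' y /\ ~ at_least n.+1 (R1 u')), n; split.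
- rewrite /def2; dp; first by apply: (def2_app dR1); cm.
  by apply: (Dp_comp (f := fun e => fstE e) (Dp_at_least n.+1 dR1)); cm.
- move=> u' [v vi vR]; have [_] := vR ord0; apply.
  by exists v => // i; have [] := vR i.
- split; first exact/RP.
  by move=> /(at_least_le (leqnSn n)) /nR.
- move=> u1 u2 E y [Ry nRy]; split; first exact: Rdep E _ Ry.
  move=> a; apply: nRy; apply: at_least_sub a => z; apply: Rdep => j Jj; exact/esym/E.
Qed.

Lemma elts_env1 (b : H) : elts (env1 b : env M h) = [set elt b].
Proof. by apply/seteqP; split=> [p [i _ ->]//|p ->]; exists ord0. Qed.

(** The solutions over all b' in the finite set P form a finite union of finite sets. *)
Lemma acl_trans1 C b x : acl_home C b -> acl_home (C `|` [set elt b]) x -> acl_home C x.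
Proof.
move=> [P [dP fP Pb]]; rewrite -elts_env1 => /acl_split[R [n [dR bR Rx _]]].
exists (fun y => exists b' : H, P b' /\ R (env1 b') y); split; last by exists b.
  rewrite /def1; dp; first by apply: (def1_app dP); cm.
  by apply: (def2_app dR); cm.
apply: (@sub_finite_set _ _ (\bigcup_(b' in [set b' | P b']) [set y | R (env1 b') y])).
  by move=> y [b' [Pb' Ry]]; exists b'.
by apply: bigcup_finite => // b' _; exact: not_at_least_finite (bR _).
Qed.

(** A definable form of Neumann's lemma. If no t' works, an enumeration of F hits every [E t']. The
    entries of the hitting tuples of minimal length then form a finite set, and this set is
    definable over D since its definition mentions Th and E but not F. One of its elements lies in
    [E t] and is algebraic over D, a contradiction. *)
Lemma avoid_finite D G (Th : env M G -> Prop) (E : env M G -> H -> Prop) (m : nat) t (F : set H) :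
  Dp D Th -> def2 D E -> (forall t', ~ at_least m.+1 (E t')) ->
  Th t -> (forall w, E t w -> ~ acl_home D w) -> finite_set F ->
  exists2 t', Th t' & forall w, E t' w -> ~ F w.
Proof.
move=> dTh dE bE Tht nacl /(@finite_seqP {classic _})[s sF].
apply: contrapT => no.
have hF : exists n, `[< exists v : 'I_n -> H, hits E Th v >].
  exists (size s); apply/asboolP; exists (fun i => tnth (in_tuple s) i) => t' Tht'.
  apply: contrapT => /forallNP nE; apply: no; exists t' => // w Ew Fw.
  have ws : (w : {classic H}) \in in_tuple s by have := Fw; rewrite sF.
  have [i wi] := tnthP _ _ ws.
  by apply: (nE i); rewrite -wi.
have [n /asboolP[v hv] nmin] := ex_minnP hF.
have fW := @finite_minimal_hitting _ _ E m bE n Th.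
have [i Ei] := hv t Tht; apply: (nacl _ Ei).
exists (fun w => exists v : env M (power (home L) n),
  (forall t' : env M G, Th t' -> exists i : 'I_n, E t' (v i)) /\ exists i : 'I_n, v i = w :> H).
split; last by exists v; split=> //; exists i.
  rewrite /def1; dp; first by apply: (Dp_comp dTh); cm.
  by apply (def2_app dE); cm.
apply: sub_finite_set (fW _); first by move=> w [v' [hv' ?]]; exists v'.
move=> s' v' s's hv'; suff : n <= s' by rewrite leqNgt s's.
by apply: nmin; apply/asboolP; exists v'.
Qed.

End Acl.

(** * Conjugates in general position *)

Lemma not_at_least_range T m (v : 'I_m -> T) : ~ at_least m.+1 (fun w => exists i, w = v i).
Proof.
move=> [u ui /(_ _)/cid-/all_sig[g hg]].
have gi : injective g by move=> i j gij; apply: ui; rewrite !hg gij.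
by have := leq_card g gi; rewrite !card_ord ltnn.
Qed.

Lemma not_at_least_False T : ~ at_least 1 (fun _ : T => False).
Proof. by move=> [u _ /(_ ord0)]. Qed.

Section Independence.
Variables (L : language) (M : structure L).
Local Notation H := (M (home L)).
Local Notation h := (single (home L)).
Implicit Types (C D : set (element M)) (G K : ctx (lsort L)).

(** The union of finitely many finite D-definable sets. It serves to remove from a finite set the
    elements algebraic over D, which no conjugation over D can move away. *)
Lemma finite_acl_trace D (S : set H) : finite_set S ->
  exists A : H -> Prop, [/\ def1 D A, finite_set [set w | A w] &
    forall w, S w -> acl_home D w -> A w].
Proof.
move=> /(@finite_seqP {classic H})[s ->]; elim: s => [|a s [A [dA fA hA]]].
  by exists (fun=> False); split=> //; rewrite /def1; dp.
have [[P [dP fP Pa]]|na] := pselect (acl_home D a); last first.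
  by exists A; split=> // w /=; rewrite inE => /orP[/eqP-> //|]; exact: hA.
exists (fun w => P w \/ A w); split.
- by rewrite /def1; dp.
- have -> : [set w | P w \/ A w] = [set w | P w] `|` [set w | A w] by [].
  by rewrite finite_setU.
- by move=> w /=; rewrite inE => /orP[/eqP->|ws aw]; [left|right; exact: hA].
Qed.

(* Two-sided genericity: some conjugate of t over D is generic over D' and, at the same
   time, zs is still generic over it. *)
Lemma generic_conjugate D D' G m m' (t : env M G) (z : env M (power (home L) m))
    (zs : env M (power (home L) m')) :
  saturated M -> small D' -> D `<=` D' ->
  (forall i : 'I_m, ~ acl_home D (z i)) -> (forall i : 'I_m', ~ acl_home D (zs i)) ->
  exists (t' : env M G) (z' : env M (power (home L) m)),
  [/\ eqtp D (t +++ z) (t' +++ z'), forall i : 'I_m, ~ acl_home D' (z' i) &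
      forall i : 'I_m', ~ acl_home (D `|` elts t') (zs i)].
Proof.
move=> sat sD' adm' nz nzs.
(* A is a condition from the type of (t, z) over D, F a finite D'-definable set that z' has to
   avoid, and R a bounded family over D whose member at t' must not contain an entry of zs. *)
pose X A (F : H -> Prop) (R : env M G -> H -> Prop) : env M (G (+) power (home L) m) -> Prop :=
    fun e =>
  A e /\ (forall i : 'I_m, ~ F (sndE e i : H)) /\ (forall i : 'I_m', ~ R (fstE e) (zs i)).
pose ok A (F : H -> Prop) (R : env M G -> H -> Prop) := [/\ Dp D A, A (t +++ z),
  def1 D' F /\ finite_set [set w | F w], def2 D R & exists n, forall t', ~ at_least n.+1 (R t')].
have ok0 A : Dp D A -> A (t +++ z) -> ok A (fun=> False) (fun _ _ => False).
  move=> dA Atz; split=> //; first by split=> //; rewrite /def1; dp.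
    by rewrite /def2; dp.
  by exists 0 => t'; exact: not_at_least_False.
have okX A F R : ok A F R -> exists e, X A F R e.
  move=> [dA Atz [dF fF] dR [n bR]].
  (* Only the part of [R t] that is not algebraic over D can be moved off zs. The part inside A0
     causes no harm, because an entry of zs in A0 would be algebraic over D. *)
  have [A0 [dA0 fA0 hA0]] := @finite_acl_trace D _ (not_at_least_finite (@bR t)).
  pose E (e : env M (G (+) power (home L) m)) (w : H) :=
    (exists i : 'I_m, w = sndE e i :> H) \/ (R (fstE e) w /\ ~ A0 w).
  have dE : def2 D E.
    rewrite /def2 /E; dp.
      by apply (def2_app dR); cm.
    by apply (def1_app dA0); cm.
  have bE e : ~ at_least (m + n).+1 (E e).
    apply: not_at_leastU; first exact: not_at_least_range.
    by move=> /(at_least_sub (Q := R (fstE e))) a; apply: (bR (fstE e)); apply: a => w [].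
  have [||e Ae hE] := avoid_finite (F :=
      [set w | F w] `|` [set w | exists i : 'I_m', w = zs i :> H])
      dA dE bE Atz.
  - move=> w [[i ->]|[Rw nA0w]]; first exact: nz.
    by move=> aw; apply: nA0w; exact: hA0.
  - by rewrite finite_setU; split=> //; exact: (not_at_least_finite (@not_at_least_range _ _ _)).
  exists e; split=> //; split=> i.
    by move=> Fi; apply: (hE (sndE e i)); [left; exists i|left].
  move=> Ri; have [A0i|nA0i] := pselect (A0 (zs i)).
    by apply: (nzs i); exists A0.
  by apply: (hE (zs i)); [right|right; exists i].
have [|||||e he] := @saturation _ _ (D' `|` elts zs) _
   (fun Y => exists A F R, ok A F R /\ Y = X A F R) sat.
- by apply: small_setU => //; exact: finite_elts.
- move=> _ [A [F [R [[dA _ [dF _] dR _] ->]]]]; rewrite /X; dp.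
  + by apply: Dp_mono dA => p /adm'; left.
  + by apply: (@def1_app _ _ (D' `|` elts zs) _ F); [apply: Dp_mono dF => p; left|cm].
  + apply: (@def2_app _ _ (D' `|` elts zs) _ _ R); [|by cm|by apply cterm_cst; right; eexists].
    by apply: Dp_mono dR => p /adm'; left.
- by exists (X (fun=> True) (fun=> False) (fun _ _ => False)); do 3 eexists; split=> //;
    apply: ok0 => //; dp.
- by move=> _ [A [F [R [/okX[e Xe] ->]]]]; exists e.
- move=> _ _ [A [F [R [ok1 ->]]]] [A' [F' [R' [ok2 ->]]]].
  exists (X (fun e => A e /\ A' e) (fun w => F w \/ F' w) (fun t w => R t w \/ R' t w)); last first.
    move=> e [[Ae A'e] [nF nR]]; split; split=> //; split=> i;
      try (by move=> Fi; apply: (nF i); tauto); by move=> Ri; apply: (nR i); tauto.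
  do 3 eexists; split; last by [].
  have [dA At [dF fF] dR [n bR]] := ok1; have [dA' At' [dF' fF'] dR' [n' bR']] := ok2.
  split; [by dp|by []| | |].
  + split; first by rewrite /def1; dp.
    have -> : [set w | F w \/ F' w] = [set w | F w] `|` [set w | F' w] by [].
    by rewrite finite_setU.
  + by rewrite /def2; dp.
  + by exists (n + n') => t'; exact: not_at_leastU.
exists (fstE e), (sndE e); split.
- move=> A dA Atz; rewrite cat_fst_snd.
  by have [] := he (X A (fun=> False) (fun _ _ => False)); first by do 3 eexists; split=> //;
      exact: ok0.
- move=> i [P [dP fP Pi]].
  have [] := he (X (fun=> True) P (fun _ _ => False)); last by move=> _ [/(_ i)].
  do 3 eexists; split; last by []. 
  by have [? ? _ ? ?] := ok0 (fun=> True) (Dp_prop _ _ _) I; split.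
- move=> i /acl_split[R [n [dR bR Ri _]]].
  have [] := he (X (fun=> True) (fun=> False) R); last by move=> _ [_ /(_ i)].
  do 3 eexists; split; last by [].
  by have [? ? ? _ _] := ok0 (fun=> True) (Dp_prop _ _ _) I; split=> //; exists n.
Qed.

Lemma eqtp_acl D G m (t t' : env M G) (z z' : env M (power (home L) m)) (i : 'I_m) :
  eqtp D (t +++ z) (t' +++ z') -> ~ acl_home (D `|` elts t) (z i) ->
  ~ acl_home (D `|` elts t') (z' i).
Proof.
move=> e nz /acl_split[R [n [dR bR Ri _]]]; apply: nz.
apply: (acl_fiber dR (@bR t)).
apply: (eqtp_sym e (A := fun e : env M (G (+) power (home L) m) => R (fstE e) (sndE e i))) => //.
by apply (def2_app dR); cm.
Qed.

(** The case of an empty tuple z and of the single entry x in zs. *)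
Lemma generic_over D G (t : env M G) x :
  saturated M -> small D -> ~ acl_home D x ->
  exists2 t', eqtp D t t' & ~ acl_home (D `|` elts t') x.
Proof.
move=> sat sD nx.
pose z0 : env M (power (home L) 0) := fun i : 'I_0 => False_rect _ (notF (ltn_ord i)).
have [||t' [z' [e _ h']]] := @generic_conjugate D D G 0 1 t z0 (env1 x) sat sD (@subset_refl _ _).
- by case.
- by move=> i.
exists t'; last exact: (h' ord0).
move=> A dA At; apply: (e (fun e => A (fstE e))) => //.
by apply (Dp_comp dA); cm.
Qed.

End Independence.

(** * Uniformities with varying parameters *)

Section Topology.
Variables (L : language) (M : structure L).
Local Notation H := (M (home L)).
Local Notation h := (single (home L)).
Hypothesis sat_M : saturated M.
(** [ent e z] is the entourage of index z in the uniformity with parameters e, and [adm e] the set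
    of its indices. The parameters are kept as variables, and everything else is definable over the
    empty set, so that conjugate uniformities can be compared. *)
Variables (W Z : ctx (lsort L)) (ent : env M W -> env M Z -> H -> H -> Prop)
  (adm : env M W -> env M Z -> Prop).
Hypothesis ent_dp : Dp set0 (fun e : env M (((W (+) Z) (+) h) (+) h) =>
  ent (fstE (fstE (fstE e))) (sndE (fstE (fstE e))) (sndE (fstE e) ord0) (sndE e ord0)).
Hypothesis adm_dp : Dp set0 (fun e : env M (W (+) Z) => adm (fstE e) (sndE e)).
Implicit Types (C D : set (element M)) (G K : ctx (lsort L)) (e : env M W) (z : env M Z).

Lemma ent_app C G (f : env M G -> env M W) (g : env M G -> env M Z) (x y : env M G -> H) :
  cmap C f -> cmap C g -> cterm C x -> cterm C y ->
  Dp C (fun v => ent (f v) (g v) (x v) (y v)).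
Proof.
move=> hf hg hx hy; apply: (Dp_comp (Dp_mono (@sub0set _ C) ent_dp)
  (cmap_cat (cmap_cat (cmap_cat hf hg) (cmap_env1 hx)) (cmap_env1 hy))).
Qed.

Lemma adm_app C G (f : env M G -> env M W) (g : env M G -> env M Z) :
  cmap C f -> cmap C g -> Dp C (fun v => adm (f v) (g v)).
Proof.
by move=> hf hg; apply: (Dp_comp (Dp_mono (@sub0set _ C) adm_dp) (cmap_cat hf hg)).
Qed.

(** All clauses but [g_int] are first-order conditions on e over the empty set; [g_int] ranges over
    all definable sets and becomes first-order through [uniform_bound]. *)
Record good e : Prop := Good {
  g_diag : forall x y, (forall z, adm e z -> ent e z x y) <-> x = y;
  g_sym : forall z, adm e z -> forall x y, ent e z x y -> ent e z y x;
  g_cap : forall z z', adm e z -> adm e z' ->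
    exists z'', adm e z'' /\ forall x y, ent e z'' x y -> ent e z x y /\ ent e z' x y;
  g_comp : forall z, adm e z ->
    exists z', adm e z' /\ forall x y t, ent e z' x y -> ent e z' y t -> ent e z x t;
  g_iso : forall z x, adm e z -> exists y, ent e z x y /\ y <> x;
  g_ne : exists z, adm e z;
  g_int : forall X, def1 setT X -> infinite_set [set x | X x] ->
    exists p z, adm e z /\ forall y, ent e z p y -> X y }.

Lemma good_refl e z x : good e -> adm e z -> ent e z x x.
Proof. by move=> ge Dz; apply: (g_diag ge x x).2. Qed.

(** A smaller ball around x excludes any given point y other than x, and again contains a point
    other than x. *)
Lemma good_ball_at_least e z x n : good e -> adm e z -> at_least n (ent e z x).
Proof.
move=> ge Dz; apply: (@at_least_sub _ _ (fun y => ent e z x y /\ y <> x)); first by move=> y [].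
elim: n z Dz => [|n IH] z Dz; first exact: at_least0.
have [y [Uy yx]] := g_iso ge x Dz.
have [z1 Dz1 nU] : exists2 z1, adm e z1 & ~ ent e z1 x y.
  apply: contrapT => no; apply: yx; apply/esym/(g_diag ge) => z1 Dz1.
  by apply: contrapT => nU; apply: no; exists z1.
have [z2 [Dz2 h2]] := g_cap ge Dz Dz1.
apply: (@at_leastS _ _ _ y); first by [].
apply: at_least_sub (IH z2 Dz2) => w [Uw wx]; split; first by split=> //; have [] := h2 _ _ Uw.
by move=> wy; apply: nU; rewrite -wy; have [] := h2 _ _ Uw.
Qed.

Lemma good_ball_infinite e z x : good e -> adm e z -> infinite_set [set y | ent e z x y].
Proof. by move=> ge Dz /finite_not_at_least[n]; apply; exact: good_ball_at_least. Qed.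

Lemma good_refine e (I : finType) (Q : I -> env M Z -> Prop) : good e ->
  (forall i z z', adm e z -> adm e z' -> (forall x y, ent e z' x y -> ent e z x y) ->
     Q i z -> Q i z') ->
  (forall i, exists z, adm e z /\ Q i z) -> exists z, adm e z /\ forall i, Q i z.
Proof.
move=> ge Qa hQ.
suff [z [Dz hz]] : exists z, adm e z /\ forall i, i \in enum I -> Q i z.
  by exists z; split=> // i; apply: hz; exact: mem_enum.
elim: (enum I) => [|i s [z [Dz hz]]].
  by have [z Dz] := g_ne ge; exists z.
have [zi [Dzi hzi]] := hQ i; have [z' [Dz' hz']] := g_cap ge Dz Dzi.
exists z'; split=> // j; rewrite inE => /orP[/eqP->|js].
  by apply: Qa hzi => // x y /hz'[].
by apply: Qa (hz _ js) => // x y /hz'[].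
Qed.

Definition ball_in e (X : H -> Prop) := exists p z, adm e z /\ forall y, ent e z p y -> X y.

Lemma ball_in_app C G (A : env M G -> H -> Prop) G' (f : env M G' -> env M W)
    (g : env M G' -> env M G) :
  def2 C A -> cmap C f -> cmap C g -> Dp C (fun v => ball_in (f v) (A (g v))).
Proof.
move=> dA hf hg; rewrite /ball_in; dp.
- by apply adm_app; [apply: (cmap_comp hf); cm|cm].
- by apply ent_app; [apply: (cmap_comp hf); cm|cm|cm|cm].
- by apply (def2_app dA); [apply: (cmap_comp hg); cm|cm].
Qed.

(** Otherwise saturation yields an infinite fibre without a ball, against [g_int]. As balls are
    infinite, infinity of a fibre is thus a definable condition on its index. *)
Lemma uniform_bound e G (A : env M G -> H -> Prop) : good e -> def2 setT A ->
  exists N, forall u, at_least N (A u) -> ball_in e (A u).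
Proof.
move=> ge dA; apply: contrapT => /forallNP no.
have {}no n : exists u, at_least n (A u) /\ ~ ball_in e (A u).
  by have /existsNP[u /not_implyP[a b]] := no n; exists u.
have [C sC dCA] := Dp_small dA.
have [|||||u hu] := @saturation _ _ (C `|` elts e) G
   (fun Y => exists n, Y = fun u => at_least n (A u) /\ ~ ball_in e (A u)) sat_M.
- by apply: small_setU => //; exact: finite_elts.
- have dA' : def2 (C `|` elts e) A by apply: Dp_mono dCA => p; left.
  move=> _ [n ->]; dp; first exact: Dp_at_least.
  by apply (ball_in_app (g := fun v => v) dA'); [apply: cmap_cst => j; right; exists j|cm].
- by exists (fun u => at_least 0 (A u) /\ ~ ball_in e (A u)); exists 0.
- by move=> _ [n ->]; exact: no.
- move=> _ _ [n ->] [m ->].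
  exists (fun u => at_least (maxn n m) (A u) /\ ~ ball_in e (A u)); first by eexists.
  by move=> u [a b]; split; split=> //; apply: at_least_le a; rewrite ?leq_maxl ?leq_maxr.
have hatl n : at_least n (A u) by have [] := hu _ (ex_intro _ n erefl).
have [_] := hu _ (ex_intro _ 0 erefl); apply; apply: (g_int ge).
  by apply: Dp_mono (def2_fiber u dA).
by move=> /finite_not_at_least[n]; apply.
Qed.

Lemma good_eqtp e e' : good e -> eqtp set0 e e' -> good e'.
Proof.
move=> ge ee.
pose U_ := ent_app; pose D_ := adm_app.
have tr (Q : env M W -> Prop) : Dp set0 Q -> Q e -> Q e' by exact: ee.
split.
- apply: (tr (fun e => forall x y : H, (forall z : env M Z, adm e z -> ent e z x y) <-> x = y));
    last exact: (g_diag ge).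
  by dp; (apply ent_app || apply adm_app); cm.
- apply: (tr (fun e => forall z : env M Z, adm e z -> forall x y : H, ent e z x y ->
    ent e z y x)); last exact: (g_sym ge).
  by dp; (apply ent_app || apply adm_app); cm.
- apply: (tr (fun e => forall z z' : env M Z, adm e z -> adm e z' -> exists z'' : env M Z,
   adm e z'' /\ forall x y : H, ent e z'' x y -> ent e z x y /\ ent e z' x y));
       last exact: (g_cap ge).
  by dp; (apply ent_app || apply adm_app); cm.
- apply: (tr (fun e => forall z : env M Z, adm e z -> exists z' : env M Z,
   adm e z' /\ forall x y t : H, ent e z' x y -> ent e z' y t -> ent e z x t));
       last exact: (g_comp ge).
  by dp; (apply ent_app || apply adm_app); cm.
- apply: (tr (fun e => forall (z : env M Z) (x : H), adm e z -> exists y : H, ent e z x y /\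
    y <> x)); last exact: (g_iso ge).
  by dp; (apply ent_app || apply adm_app); cm.
- apply: (tr (fun e => exists z : env M Z, adm e z)); last exact: (g_ne ge).
  by dp; (apply ent_app || apply adm_app); cm.
(* The parameters of X are made variable. That every fibre with at least N elements contains a ball
   is a condition on e over the empty set, so it passes from e to e'. *)
- move=> X [K [phi [k [_ E]]]] iX.
  pose A (u : env M K) (y : H) := sat phi (env1 y +++ u).
  have dA : def2 set0 A by apply: (Dp_sat phi); cm.
  have [N hN] := uniform_bound ge (Dp_mono (C' := setT) (fun _ _ => I) dA).
  have E' y : A k y <-> X y by exact: E.
  have : ball_in e' (A k).
    apply: (tr (fun e => forall u : env M K, at_least N (A u) -> ball_in e (A u))) => //.
      dp; first by apply (Dp_comp (f := fun v => sndE v) (Dp_at_least N dA)); cm.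
      by apply (ball_in_app dA); cm.
    by apply: infinite_at_least => fX; apply: iX; apply: sub_finite_set fX => y /E'.
  by move=> [p [z [Dz h']]]; exists p, z; split=> // y /h' /E'.
Qed.

(** * Neighbourhood filters at a point and their dependence on the parameters *)

Definition finer e e' x := forall z', adm e' z' ->
  exists z, adm e z /\ forall w, ent e z x w -> ent e' z' x w.

(** Equality of the neighbourhood filters of x in the two uniformities. *)
Definition same_germ e e' x := finer e e' x /\ finer e' e x.

Lemma finer_trans e1 e2 e3 x : finer e1 e2 x -> finer e2 e3 x -> finer e1 e3 x.
Proof.
move=> h12 h23 z /h23[z' [Dz' hz']]; have [z'' [Dz'' hz'']] := h12 _ Dz'.
by exists z''; split=> // w /hz''/hz'.
Qed.

Lemma same_germ_trans e1 e2 e3 x : same_germ e1 e2 x -> same_germ e2 e3 x -> same_germ e1 e3 x.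
Proof. by move=> [a b] [c d]; split; [exact: finer_trans c|exact: finer_trans b]. Qed.

Lemma same_germ_sym e1 e2 x : same_germ e1 e2 x -> same_germ e2 e1 x.
Proof. by case. Qed.

Lemma same_germ_app C G (f g : env M G -> env M W) x :
  cmap C f -> cmap C g -> cterm C x -> Dp C (fun v => same_germ (f v) (g v) (x v)).
Proof.
move=> hf hg hx; rewrite /same_germ /finer; dp.
all: try (apply adm_app; [(apply: (cmap_comp hf); cm) || (apply: (cmap_comp hg); cm)|cm]).
all: try (apply ent_app; [(apply: (cmap_comp hf); cm) || (apply: (cmap_comp hg); cm)|cm|
       apply: (cterm_comp hx); cm|cm]).
Qed.

(* If infinitely many x had a basic e'-neighbourhood containing no e-ball around x, an
   e'-ball of such x's would contain an e-ball around one of its points. *)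
Lemma finite_not_finer e e' : good e -> good e' -> finite_set [set x | ~ finer e e' x].
Proof.
move=> ge ge'.
pose A z' x := adm e' z' /\ forall z, adm e z -> exists w : H, ent e z x w /\ ~ ent e' z' x w.
have dA : def2 setT A.
  by rewrite /def2 /A; dp; (apply ent_app || apply adm_app); cm.
have fA z' : ~ ball_in e' (A z').
  move=> [p [z1 [Dz1 hz1]]].
  have [Dz' _] := hz1 p (good_refl p ge' Dz1).
  have [z2 [Dz2 hz2]] := g_comp ge' Dz'.
  have [z3 [Dz3 hz3]] := g_cap ge' Dz1 Dz2.
  have d3 : def1 setT (ent e' z3 p) by rewrite /def1; apply ent_app; cm.
  (* The e'-ball of index z3 around p contains an e-ball around some r. Through p, all points of
     that e-ball are z'-close to r, which contradicts that r lies in [A z']. *)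
  have [r [z4 [Dz4 hz4]]] := g_int ge d3 (good_ball_infinite ge' Dz3).
  have U3r : ent e' z3 p r by apply: hz4; exact: good_refl.
  have [_ /(_ _ Dz4)[w [Uw nUw]]] := hz1 _ (hz3 _ _ U3r).1; apply: nUw.
  apply: (hz2 _ p); last exact: (hz3 _ _ (hz4 _ Uw)).2.
  by apply: (g_sym ge' Dz2); exact: (hz3 _ _ U3r).2.
have [N hN] := uniform_bound ge' dA.
apply: (@not_at_least_finite _ N) => -[u ui uP].
(* A failure at a point persists when z' shrinks, so one index serves all N points. *)
have [|i|z' [Dz' hz']] := @good_refine e' _ (fun (i : 'I_N) z' => A z' (u i)) ge'.
- move=> i z z' Dz Dz' zz' [_ h']; split=> // z1 /h'[w [Uw nUw]].
  by exists w; split=> // /zz'.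
- have /existsNP[z' /not_implyP[Dz' no]] := uP i; exists z'; split=> //; split=> // z Dz.
  apply: contrapT => /forallNP nw; apply: no; exists z; split=> // w Uw.
  by apply: contrapT => nUw; apply: (nw w).
by apply: (fA z'); apply: hN; exists u.
Qed.

Lemma finite_germ_change e e' : good e -> good e' -> finite_set [set x | ~ same_germ e e' x].
Proof.
move=> ge ge'.
apply: (@sub_finite_set _ _ ([set x | ~ finer e e' x] `|` [set x | ~ finer e' e x])).
  by move=> x /= n; apply: contrapT => /not_orP[/contrapT a /contrapT b]; apply: n.
by rewrite finite_setU; split; exact: finite_not_finer.
Qed.

Lemma germ_change_acl e e' x : good e -> good e' -> ~ same_germ e e' x ->
  acl_home (elts e `|` elts e') x.
Proof.
move=> ge ge' nx; exists (fun x => ~ same_germ e e' x); split=> //.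
  by rewrite /def1; dp; apply same_germ_app; [apply: cmap_cst => j; left; exists j|
    apply: cmap_cst => j; right; exists j|cm].
exact: finite_germ_change.
Qed.

Lemma same_germ_off_acl e e' x : good e -> eqtp set0 e e' ->
  ~ acl_home (elts e) x -> ~ acl_home (elts e') x -> same_germ e e' x.
Proof.
move=> ge ee' nx nx'; apply: contrapT => nxx.
(* The number of bad points is bounded uniformly in the conjugate e2, yet it can be doubled. *)
pose bad m := exists (e2 : env M W) (z : 'I_m -> H), [/\ eqtp set0 e e2, injective z &
  forall i, [/\ ~ same_germ e e2 (z i), ~ acl_home (elts e) (z i) & ~ acl_home (elts e2) (z i)]].
have bad1 : bad 1.
  by exists e', (fun=> x); split=> // i j _; rewrite (ord1 i) (ord1 j).
have [N hN] : exists N, forall m, bad m -> m < N.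
  pose A e2 x := ~ same_germ e e2 x.
  have dA : def2 setT A by rewrite /def2 /A; dp; apply same_germ_app; cm.
  have [N hN] := uniform_bound ge dA; exists N => m [e2 [z [ee2 zi hz]]].
  rewrite ltnNge; apply/negP => Nm.
  have [|p [z0 [Dz0 hz0]]] := hN e2.
    by apply: (at_least_le Nm); exists z => // i; have [] := hz i.
  apply: (good_ball_infinite ge Dz0).
  by apply: sub_finite_set (finite_germ_change ge (good_eqtp ge ee2)) => y /hz0.
suff badD m : bad m -> bad (m + m).
  have bad2 n : bad (2 ^ n) by elim: n => // n /badD; rewrite addnn -mul2n -expnS.
  by have := hN _ (bad2 N); rewrite ltnNge ltnW // ltn_expl.
move=> [e2 [z [ee2 zi hz]]].
have ge2 := good_eqtp ge ee2.
have sD : small (elts e `|` elts e2) by apply: small_finite; rewrite finite_setU; split;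
    exact: finite_elts.
have n2 i : ~ acl_home (elts e2) (z i) by have [] := hz i.
(* The pair (e3, z3) is conjugate to (e, z) over e2. At z the filters of e2 and e3 agree, so e and
   e3 differ there; at z3 those of e and e2 agree while e3 and e2 differ by conjugacy, so e and e3
   differ again. The points of z are algebraic over e and e2 and those of z3 are not, so the two
   tuples are disjoint. *)
have [|||e3 [z3 [e23 nz3 nz]]] :=
    @generic_conjugate _ _ (elts e2) (elts e `|` elts e2) _ m m e z z sat_M sD.
- by move=> p; right.
- exact: n2.
- exact: n2.
have e23' : eqtp set0 (e +++ (z : env M (power (home L) m))) (e3 +++ z3).
  exact: eqtp_mono e23.
have ee3 : eqtp set0 e e3.
  by move=> A dA Ae; apply: (e23' (fun v => A (fstE v))) => //; apply (Dp_comp dA); cm.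
have ge3 := good_eqtp ge ee3.
have s23 i : same_germ e2 e3 (z i).
  by apply: contrapT => /(germ_change_acl ge2 ge3); exact: nz.
have s2z3 i : same_germ e e2 (z3 i).
  by apply: contrapT => /(germ_change_acl ge ge2); exact: nz3.
have n3 i : ~ same_germ e e3 (z3 i).
  move=> s; have [ni _ _] := hz i; have : ~ same_germ e3 e2 (z3 i).
    apply: (e23 (fun v => ~ same_germ (fstE v) e2 (sndE v i))) => //.
    by dp; apply same_germ_app; [cm|apply: cmap_cst => j; exists j|cm].
  by apply; exact: same_germ_trans (same_germ_sym s) (s2z3 i).
have zacl i : acl_home (elts e `|` elts e2) (z i).
  by have [ni _ _] := hz i; exact: germ_change_acl.
have z3i i j : z3 i = z3 j :> H -> i = j.
  apply: contraPP => ij; apply: (e23' (fun v => sndE v i <> sndE v j :> H)); first by dp.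
  by move=> /zi.
have zz3 i j : z i <> z3 j by move=> E; apply: (nz3 j); rewrite -E; exact: zacl.
exists e3, (fun k => match fintype.split k with inl i => z i | inr i => z3 i end); split=> //.
  move=> k k' E; apply: (can_inj (@splitK m m)); move: E.
  case: (fintype.split k) => i; case: (fintype.split k') => j.
  - by move=> /zi ->.
  - by move=> /zz3.
  - by move=> /esym/zz3.
  - by move=> /z3i ->.
move=> k; case: (fintype.split k) => i; split.
- have [ni _ _] := hz i; move=> s; apply: ni.
  exact: same_germ_trans s (same_germ_sym (s23 i)).
- by have [] := hz i.
- by move=> a; apply: (nz i); apply: acl_mono a => p; right.
- exact: n3.
- by move=> a; apply: (nz3 i); apply: acl_mono a => p; left.
- have := @eqtp_acl _ _ set0 _ _ _ _ _ _ i e23'; rewrite !set0U; apply.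
  by have [] := hz i.
Qed.

(** If infinite, this definable set would contain a ball, whose centre would be an interior point of
    X. *)
Lemma finite_boundary e X : good e -> def1 setT X ->
  finite_set [set x | X x /\ ~ exists z, adm e z /\ forall y, ent e z x y -> X y].
Proof.
move=> ge dX; apply: contrapT => iX.
have [|p [z [Dz hz]]] := g_int ge _ iX.
  rewrite /def1; dp.
  - by apply (def1_app dX); cm.
  - by apply adm_app; cm.
  - by apply ent_app; cm.
  - by apply (def1_app dX); cm.
have [_ []] := hz p (good_refl p ge Dz).
by exists z; split=> // y /hz[].
Qed.

(** The difficulty is that x may be algebraic over the union of the [C i]. For each i a conjugate
    [e i] of e0 over [C i] is chosen over which x stays generic, so that x is interior to [A i] in
    that uniformity. The filters of all [e i] at x coincide by [same_germ_off_acl], hence one ball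
    around x lies in every [A i]. *)
Lemma infinite_common e0 (I : finType) (C : I -> set (element M)) (A : I -> H -> Prop) x :
  good e0 -> (forall i, small (C i)) -> (forall i, def1 (C i) (A i)) ->
  (forall i, A i x) -> (forall i, ~ acl_home (C i) x) ->
  infinite_set [set y | forall i, A i y].
Proof.
move=> ge0 sC dA Ax nx.
have /(_ _)/cid2-/all_sig2[e he ne] i := @generic_over _ _ (C i) _ e0 x sat_M (sC i) (@nx i).
have {}he i : eqtp set0 e0 (e i) by exact: eqtp_mono (he i).
have ge i := good_eqtp ge0 (he i).
have Ui i : exists z, adm (e i) z /\ forall y, ent (e i) z x y -> A i y.
  apply: contrapT => no; apply: (ne i).
  exists (fun x => A i x /\ ~ exists z, adm (e i) z /\ forall y, ent (e i) z x y -> A i y).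
  split=> //; last by apply: finite_boundary => //; exact: Dp_mono (dA i).
  have d1 : def1 (C i `|` elts (e i)) (A i) by apply: Dp_mono (dA i) => p; left.
  have c1 G : cmap (C i `|` elts (e i)) (fun _ : env M G => e i).
    by apply: cmap_cst => j; right; exists j.
  rewrite /def1; dp.
  - by apply (def1_app d1); cm.
  - by apply adm_app; cm.
  - by apply ent_app; cm.
  - by apply (def1_app d1); cm.
(* Any of the [e i] serves as reference; for empty I, e0 does. *)
have [e1 ge1 he1] : exists2 e1, good e1 & forall i, same_germ e1 (e i) x.
  have [[i0 _]|no] := pselect (exists i : I, True); last first.
    by exists e0 => // i; case: no; exists i.
  exists (e i0) => // i; apply: same_germ_off_acl => //.
  - exact: eqtp_trans (eqtp_sym (he i0)) (he i).
  - by move=> a; apply: (ne i0); apply: acl_mono a => p; right.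
  - by move=> a; apply: (ne i); apply: acl_mono a => p; right.
have [||z [Dz hz]] := @good_refine e1 I (fun i z => forall y, ent e1 z x y -> A i y) ge1.
- by move=> i z z' _ _ zz' hz y /zz'/hz.
- move=> i; have [z [Dz hz]] := Ui i; have [f _] := he1 i; have [z' [Dz' hz']] := f z Dz.
  by exists z'; split=> // y /hz'/hz.
by move=> fA; apply: (@good_ball_infinite _ _ x ge1 Dz); apply: sub_finite_set fA => y Uy i;
    exact: hz.
Qed.

(** * Boxes and finite grids *)

Definition has_int e n (X : env M (power (home L) n) -> Prop) :=
  exists (p : env M (power (home L) n)) (z : env M Z), adm e z /\
    forall u : env M (power (home L) n), (forall i : 'I_n, ent e z (p i) (u i)) -> X u.

(** A grid with m points on each of n axes is stored as one flat tuple indexed by pairs, so that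
    formulas can quantify over grids; f chooses a point on every axis. *)
Definition point n m (s : env M (power (home L) #|{: 'I_n * 'I_m}|)) (f : {ffun 'I_n -> 'I_m}) :
  env M (power (home L) n) := fun i => s (enum_rank (i, f i)).

Definition is_grid n m (s : env M (power (home L) #|{: 'I_n * 'I_m}|))
    (X : env M (power (home L) n) -> Prop) :=
  (forall (i : 'I_n) (j j' : 'I_m), s (enum_rank (i, j)) = s (enum_rank (i, j')) :> H -> j = j') /\
  forall f : {ffun 'I_n -> 'I_m}, X (point s f).

Definition has_grid n m (X : env M (power (home L) n) -> Prop) := exists s, @is_grid n m s X.

Definition grid_of n m (S : 'I_n -> 'I_m -> H) : env M (power (home L) #|{: 'I_n * 'I_m}|) :=
  fun k => S (enum_val k).1 (enum_val k).2.

Lemma grid_ofE n m (S : 'I_n -> 'I_m -> H) i j : grid_of S (enum_rank (i, j)) = S i j.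
Proof. by rewrite /grid_of enum_rankK. Qed.

Lemma is_grid_of n m (S : 'I_n -> 'I_m -> H) (X : env M (power (home L) n) -> Prop) :
  (forall i, injective (S i)) -> (forall f : {ffun 'I_n -> 'I_m}, X (fun i => S i (f i))) ->
  is_grid (grid_of S) X.
Proof.
move=> Si SX; split=> [i j j'|f]; first by rewrite !grid_ofE => /Si.
suff -> : point (grid_of S) f = (fun i => S i (f i)) by [].
by apply: fext => i; rewrite /point grid_ofE.
Qed.

Lemma has_grid_le n m m' (X : env M (power (home L) n) -> Prop) :
  m <= m' -> has_grid m' X -> has_grid m X.
Proof.
move=> mm [s [si sX]].
exists (grid_of (fun i j => s (enum_rank (i, widen_ord mm j)))); apply: is_grid_of.
  by move=> i j j' /si /(congr1 val) /= jj; apply: val_inj.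
move=> f; have := sX [ffun i => widen_ord mm (f i)]; congr X.
by apply: fext => i; rewrite /point ffunE.
Qed.

Lemma point_app C G n m (g : env M G -> env M (power (home L) #|{: 'I_n * 'I_m}|))
    (f : {ffun 'I_n -> 'I_m}) : cmap C g -> cmap C (fun v => point (g v) f).
Proof. by move=> hg i; exact: (hg (enum_rank (i, f i))). Qed.

Definition defn C G n (Y : env M G -> env M (power (home L) n) -> Prop) :=
  Dp C (fun v : env M (G (+) power (home L) n) => Y (fstE v) (sndE v)).

Lemma is_grid_app C G n m (Y : env M G -> env M (power (home L) n) -> Prop) G'
    (g : env M G' -> env M (power (home L) #|{: 'I_n * 'I_m}|)) (f : env M G' -> env M G) :
  defn C Y -> cmap C g -> cmap C f -> Dp C (fun v => is_grid (g v) (Y (f v))).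
Proof.
move=> dY hg hf; rewrite /is_grid; dp.
- exact: hg.
- exact: hg.
- by apply (Dp_app2 dY) => //; exact: point_app.
Qed.

Lemma has_grid_app C G n m (Y : env M G -> env M (power (home L) n) -> Prop) G' 
    (f : env M G' -> env M G) :
  defn C Y -> cmap C f -> Dp C (fun v => has_grid m (Y (f v))).
Proof.
move=> dY hf; rewrite /has_grid; dp; apply (is_grid_app (f := fun v => f (fstE v)) dY); first by cm.
by apply: (cmap_comp hf); cm.
Qed.

Lemma int_grid e n m (X : env M (power (home L) n) -> Prop) :
  good e -> has_int e X -> has_grid m X.
Proof.
move=> ge [p [z [Dz hz]]].
have /(_ _)/cid2-/all_sig2[S Si SU] (i : 'I_n) := @good_ball_at_least e z (p i) m ge Dz.
by exists (grid_of S); apply: is_grid_of => // f; apply: hz => i; exact: SU.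
Qed.

Lemma eq_tup0 (u v : env M (power (home L) 0)) : u = v.
Proof. by apply: fext => -[]. Qed.

(** Here v codes a ball, by centre and index, whose product with each s in [Y v] lies in X. A box in
    [Y v] times that ball, both shrunk to a common index, is a box in X. *)
Lemma has_int_cons e n (X : env M (power (home L) n.+1) -> Prop)
    (Y : env M (h (+) Z) -> env M (power (home L) n) -> Prop) :
  good e ->
  (forall v s, Y v s -> adm e (sndE v) /\
     forall x : H, ent e (sndE v) (fstE v ord0) x -> X (cons_fun x s)) ->
  (exists v, has_int e (Y v)) -> has_int e X.
Proof.
move=> ge YX [v [p [z [Dz hz]]]].
have [Dv _] : adm e (sndE v) /\ forall x : H, ent e (sndE v) (fstE v ord0) x -> X (cons_fun x p).
  by apply: YX; apply: hz => i; exact: good_refl.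
have [z2 [Dz2 hz2]] := g_cap ge Dz Dv.
exists (cons_fun (fstE v ord0 : H) p), z2; split=> // u hu.
rewrite -(@cons_fun_eta H n u).
have [|_] := YX v (fun j => u (lift ord0 j)).
  by apply: hz => i; have := hu (lift ord0 i); rewrite cons_funS => /hz2[].
by apply; have := hu ord0; rewrite cons_fun0 => /hz2[].
Qed.

(* A grid in M^(n+1) is {x_1, ..., x_m} x grid; for m large the fibre {x | {x} x grid in X} is
   infinite by [uniform_bound] and contains a ball, which reduces the claim to the family, indexed
   by balls b, of the sets {s | b x {s} in X} in M^n. *)
Lemma grid_int e n G (Y : env M G -> env M (power (home L) n) -> Prop) :
  good e -> defn setT Y -> (forall m, exists w, has_grid m (Y w)) ->
  exists w, has_int e (Y w).
Proof.
move=> ge; elim: n G Y => [|n IH] G Y dY hY.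
  have [w [s [_ hs]]] := hY 0; exists w; have [z Dz] := g_ne ge.
  exists (fun i : 'I_0 => False_rect _ (notF (ltn_ord i))), z; split=> // u _.
  by rewrite (eq_tup0 u (point s [ffun i => i])); exact: hs.
have [C sC dCY] := Dp_small dY.
(* Saturation selects one fibre that has grids of every size. *)
have [|||||w hw] := @saturation _ _ C G (fun Q => exists m, Q = fun w => has_grid m (Y w)) sat_M.
- by [].
- by move=> _ [m ->]; apply (has_grid_app (f := fun v => v) m dCY); cm.
- by exists (fun w => has_grid 0 (Y w)); exists 0.
- by move=> _ [m ->]; exact: hY.
- move=> _ _ [m1 ->] [m2 ->].
  exists (fun w => has_grid (maxn m1 m2) (Y w)); first by eexists.
  by move=> w a; split; apply: has_grid_le a; rewrite ?leq_maxl ?leq_maxr.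
have {}hw m : has_grid m (Y w) by exact: hw (ex_intro _ m erefl).
exists w; set X := Y w in hw *.
have dX : Dp setT X by apply (Dp_app2 dY); cm.
pose Zf (v : env M (h (+) Z)) (s : env M (power (home L) n)) := adm e (sndE v) /\
    forall x : H, ent e (sndE v) (fstE v ord0) x -> X (cons_fun x s).
apply: (@has_int_cons e n X Zf) => //; apply: IH.
  by rewrite /defn /Zf; dp; [apply adm_app; cm|apply ent_app; cm|apply (Dp_comp dX); cm].
move=> m.
pose A (s : env M (power (home L) #|{: 'I_n * 'I_m}|)) (x : H) :=
  forall f : {ffun 'I_n -> 'I_m}, X (cons_fun x (point s f)).
have dA : def2 setT A.
  rewrite /def2 /A; apply Dp_allF => f; apply (Dp_comp dX); apply cmap_cons; first by cm.
  by apply: point_app; cm.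
have [N hN] := uniform_bound ge dA.
have mN : m <= maxn m N by exact: leq_maxl.
have Nm : N <= maxn m N by exact: leq_maxr.
have [S [Si SX]] := hw (maxn m N).
(* The first axis of the large grid provides at least N values of x, and the other axes are
   truncated to m points. *)
pose s := grid_of (fun (i : 'I_n) (j : 'I_m) => S (enum_rank (lift ord0 i, widen_ord mN j)) : H).
have [|p [z [Dz hz]]] := hN s.
  apply: (at_least_le Nm); exists (fun j => S (enum_rank (ord0, j))); first by move=> j j' /Si.
  move=> j f; have := SX [ffun i => if unlift ord0 i is Some k then widen_ord mN (f k) else j].
  congr X; apply: fext => i; rewrite /point ffunE; case: (unliftP ord0 i) => [k ->|->].
    by rewrite cons_funS /s grid_ofE.
  by rewrite cons_fun0.
exists ((env1 p : env M h) +++ z), s; split.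
  by move=> i j j'; rewrite /s !grid_ofE => /Si /(congr1 val) /= jj; apply: val_inj.
by move=> f; split=> // x Ux; exact: hz Ux f.
Qed.

Lemma indep_int e n C (X : env M (power (home L) n) -> Prop) (a : env M (power (home L) n)) :
  good e -> small C -> Dp C X -> X a ->
  (forall i : 'I_n, ~ acl_home (C `|` elts_on a (fun j => j <> i)) (a i)) -> has_int e X.
Proof.
move=> ge; elim: n C X a => [|n IH] C X a sC dX Xa na.
  have [z Dz] := g_ne ge; exists a, z; split=> // u _.
  by rewrite (eq_tup0 u a).
pose a0 : H := a ord0; pose y : env M (power (home L) n) := fun j => a (lift ord0 j).
have aE : a = cons_fun a0 y by rewrite -(@cons_fun_eta H n a).
pose Zf (v : env M (h (+) Z)) (s : env M (power (home L) n)) := adm e (sndE v) /\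
    forall x : H, ent e (sndE v) (fstE v ord0) x -> X (cons_fun x s).
apply: (@has_int_cons e n X Zf) => //; apply: grid_int => //.
  have dXT : Dp setT X by exact: Dp_mono dX.
  by rewrite /defn /Zf; dp; [apply adm_app; cm|apply ent_app; cm|apply (Dp_comp dXT); cm].
move=> m.
set C0 := C `|` [set elt a0].
have sC0 : small C0 by apply: small_setU => //; exact: finite_set1.
have dX0 : Dp C0 X by apply: Dp_mono dX => p; left.
(* R ranges over the bounded families over C, that is, over the ways in which a0 could be algebraic
   over C and s. *)
pose YR (R : env M (power (home L) n) -> H -> Prop) (s : env M (power (home L) n)) :=
    X (cons_fun a0 s) /\ ~ R s a0.
pose ok (R : env M (power (home L) n) -> H -> Prop) := def2 C R /\
    exists N, forall s, ~ at_least N.+1 (R s).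
have dYR R : ok R -> Dp C0 (YR R).
  move=> [dR _]; have dR0 : def2 C0 R by apply: Dp_mono dR => p; left.
  have c0 G : cterm C0 (fun _ : env M G => a0) by apply: cterm_cst; right.
  rewrite /YR; dp; first by apply (Dp_comp dX0); apply cmap_cons; [exact: c0|cm].
  by apply (def2_app dR0); [cm|exact: c0].
have gridR R : ok R -> has_grid m (YR R).
  move=> okR; apply: (int_grid (e := e)) => //; apply: (IH C0 _ y) => //.
  - exact: dYR.
  - split; first by rewrite -aE.
    move=> Ra; have [dR [N bR]] := okR; apply: (na ord0).
    apply: acl_mono (acl_fiber dR (@bR y) Ra) => p [|[j _ ->]]; [by left|right].
    by exists (lift ord0 j) => // E; have := congr1 val E.
  - move=> i ai; apply: (na (lift ord0 i)); apply: acl_mono ai => p [[|->]|[j ji ->]].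
    + by left.
    + by right; exists ord0 => // E; have := congr1 val E.
    + by right; exists (lift ord0 j) => // /lift_inj.
(* One grid s is found for all R at once, so a0 is not algebraic over C and any point of s. *)
have [|||||s hs] := @saturation _ _ C0 _ (fun Q => exists R, ok R /\ Q = fun s =>
    @is_grid n m s (YR R)) sat_M.
- by [].
- move=> _ [R [okR ->]].
  have d : defn C0 (fun (_ : env M Defs.Nil) s => YR R s) by apply (Dp_comp (dYR R okR)); cm.
  apply (is_grid_app (g := fun v => v) (f := fun _ => @empty_env _ M) d); first by cm.
  by apply: cmap_cst => -[].
- exists (fun s => @is_grid n m s (YR (fun _ _ => False))); exists (fun _ _ => False); split=> //.
  split; first by rewrite /def2; dp.
  by exists 0 => s; exact: not_at_least_False.
- by move=> _ [R [okR ->]]; exact: gridR.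
- move=> _ _ [R1 [[dR1 [N1 b1]] ->]] [R2 [[dR2 [N2 b2]] ->]].
  exists (fun s => @is_grid n m s (YR (fun s x => R1 s x \/ R2 s x))).
    exists (fun s x => R1 s x \/ R2 s x); split=> //; split; first by rewrite /def2; dp.
    by exists (N1 + N2) => s; exact: not_at_leastU.
  by move=> s [si sY]; split; split=> // f; have [Xf nR] := sY f; split=> // Rf; apply: nR; tauto.
have ok0 : ok (fun _ _ => False).
  split; first by rewrite /def2; dp.
  by exists 0 => t; exact: not_at_least_False.
have [si hsX] := hs _ (ex_intro _ _ (conj ok0 erefl)).
(* a0 is generic over the parameters of each fibre separately, as [infinite_common] demands. *)
have inf : infinite_set [set x : H | forall f : {ffun 'I_n -> 'I_m}, X (cons_fun x (point s f))].
  apply: (@infinite_common e _ (fun f => C `|` elts (point s f)) _ a0) => //.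
  - by move=> f; apply: small_setU => //; exact: finite_elts.
  - move=> f; have dX' : Dp (C `|` elts (point s f)) X by apply: Dp_mono dX => p; left.
    rewrite /def1; apply (Dp_comp dX'); cm.
    by apply: cmap_cst => j; right; exists j.
  - by move=> f; have [] := hsX f.
  - move=> f /acl_split[R [N [dR bR Rf _]]].
    have okR : ok R by split=> //; exists N.
    by have [_ /(_ f)[_]] := hs _ (ex_intro _ _ (conj okR erefl)).
have [|p [z [Dz hz]]] := g_int ge _ inf.
  rewrite /def1; apply Dp_allF => f.
  have dXT : Dp setT X by exact: Dp_mono dX.
  by apply (Dp_comp dXT); cm.
exists ((env1 p : env M h) +++ z), s; split=> // f; split=> // x Ux.
exact: hz Ux f.
Qed.

(** * Pairs algebraic over a single element *)

Lemma separate_finite e (F : H -> Prop) b : good e -> finite_set [set w | F w] ->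
  exists z, adm e z /\ forall w, F w -> ent e z b w -> w = b.
Proof.
move=> ge /(@finite_seqP {classic H})[s sF].
have [||z [Dz hz]] := @good_refine e _
    (fun (i : 'I_(size s)) z => ent e z b (tnth (in_tuple s) i) ->
        (tnth (in_tuple s) i : H) = b) ge.
- by move=> i z z' _ _ zz' hz /zz'/hz.
- move=> i; have [->|ne] := pselect ((tnth (in_tuple s) i : H) = b).
    by have [z Dz] := g_ne ge; exists z.
  apply: contrapT => /forallNP no; apply: ne; apply/esym/(g_diag ge) => z Dz.
  by apply: contrapT => nU; apply: (no z).
exists z; split=> // w Fw.
have ws : (w : {classic H}) \in in_tuple s by have : [set w | F w] w by []; rewrite sF.
by have [i ->] := tnthP _ _ ws; exact: hz.
Qed.

(* A point t algebraic over which are both coordinates of a generic pair would, locally, give a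
   map from M onto an open box of M^2, hence dp-rank 2. *)
Lemma pair_not_spanned e C (b c t : H) : good e -> ~ dp_rank_gt [set: env M h] 1 -> small C ->
  ~ acl_home (C `|` [set elt c]) b -> ~ acl_home (C `|` [set elt b]) c ->
  acl_home (C `|` [set elt t]) b -> acl_home (C `|` [set elt t]) c -> False.
Proof.
move=> ge ndp sC nb nc; rewrite -elts_env1.
move=> /acl_split[R1 [N1 [dR1 bR1 R1b _]]] /acl_split[R2 [N2 [dR2 bR2 R2c _]]].
pose X (u : env M (power (home L) 2)) :=
  exists t : H, R1 (env1 t) (u ord0) /\ R2 (env1 t) (u ord_max).
(* Beyond membership in X, t is required to have no other value of R1 or R2 within z of the
   coordinates of u. On a finite grid one z works for all points, and [grid_int] then provides a z
   that works on a whole box. *)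
pose Y z (u : env M (power (home L) 2)) := adm e z /\ exists t : H,
  (R1 (env1 t) (u ord0) /\ R2 (env1 t) (u ord_max)) /\
  ((forall w : H, R1 (env1 t) w -> ent e z (u ord0) w -> w = u ord0) /\
   (forall w : H, R2 (env1 t) w -> ent e z (u ord_max) w -> w = u ord_max)).
have I2 (i : 'I_2) : i = ord0 \/ i = ord_max.
  by case: i => -[|[|//]] i2; [left|right]; apply: val_inj.
have dR1T : def2 setT R1 by exact: Dp_mono dR1.
have dR2T : def2 setT R2 by exact: Dp_mono dR2.
have iX : has_int e X.
  pose a : env M (power (home L) 2) := fun i : 'I_2 => if i == ord0 then b else c.
  apply: (@indep_int e 2 C X a) => //.
  - by rewrite /X; dp; [apply (def2_app dR1); cm|apply (def2_app dR2); cm].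
  - by exists t.
  - move=> i; case: (I2 i) => ->; rewrite /a /=.
      move=> ab; apply: nb; apply: acl_mono ab => p [|[j]]; first by left.
      by case: (I2 j) => -> // _ ->; right.
    move=> ac; apply: nc; apply: acl_mono ac => p [|[j]]; first by left.
    by case: (I2 j) => -> // _ ->; right.
have [||z [p [z1 [Dz1 hz1]]]] := @grid_int e 2 Z Y ge.
- rewrite /defn /Y; dp.
  + by apply adm_app; cm.
  + by apply (def2_app dR1T); cm.
  + by apply (def2_app dR2T); cm.
  + by apply (def2_app dR1T); cm.
  + by apply ent_app; cm.
  + by apply (def2_app dR2T); cm.
  + by apply ent_app; cm.
- move=> m; have [s [si sX]] := int_grid m ge iX.
  have /(_ _)/cid-/all_sig[T hT] := sX.
  have [||z [Dz hz]] := @good_refine e _ (fun (f : {ffun 'I_2 -> 'I_m}) z =>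
     (forall w : H, R1 (env1 (T f)) w -> ent e z (point s f ord0) w -> w = point s f ord0) /\
     (forall w : H, R2 (env1 (T f)) w -> ent e z (point s f ord_max) w ->
         w = point s f ord_max)) ge.
  + by move=> f z z' _ _ zz' [h1 h2]; split=> w Rw /zz' U; [exact: h1|exact: h2].
  + move=> f.
    have [z1 [Dz1 hz1]] := separate_finite (point s f ord0) ge (not_at_least_finite (@bR1 (env1
        (T f)))).
    have [z2 [Dz2 hz2]] := separate_finite (point s f ord_max) ge (not_at_least_finite (@bR2
        (env1 (T f)))).
    have [z3 [Dz3 hz3]] := g_cap ge Dz1 Dz2.
    by exists z3; split=> //; split=> w Rw /hz3[U1 U2]; [exact: hz1|exact: hz2].
  exists z, s; split=> // f; split=> //; exists (T f); split; first exact: hT.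
  exact: hz.
have [Dz _] : Y z p by apply: hz1 => i; exact: good_refl.
have [z2 [Dz2 hz2]] := g_comp ge Dz.
have [z3 [Dz3 hz3]] := g_cap ge Dz1 Dz2.
apply: ndp.
have mkphi (R : env M h -> H -> Prop) : def2 setT R -> exists phi : pformula M (h (+) h),
    forall (t : H) (y : env M h), psat phi (env1 t +++ y) <-> R (env1 t) (y ord0).
  by move=> [K [phi [k [_ E]]]]; exists (PFormula phi k) => t' y; rewrite /psat /= E.
have [phi1 E1] := mkphi _ dR1T; have [phi2 E2] := mkphi _ dR2T.
(* The two infinite sets of the array are balls of index z3 around the coordinates of p. *)
exists (fun=> h), (fun i => if i == ord0 then phi1 else phi2),
  (fun i => [set y : env M h | ent e z3 (p i) (y ord0)]); split.
  move=> i fB; apply: (@good_ball_infinite _ _ (p i) ge Dz3).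
  apply: sub_finite_set (finite_image (fun y : env M h => y ord0 : H) fB) => y Uy.
  by exists (env1 y).
move=> v hv.
have [_ [t' [[Rt1 Rt2] [ht1 ht2]]]] : Y z (fun i => v i ord0).
  by apply: hz1 => i; have := hv i => /hz3[].
(* Two points of the same ball are z-close, so the isolation clause of Y leaves [v i] as the only
   value of t' in it. *)
have near i y : ent e z3 (p i) (y ord0) -> ent e z (v i ord0) (y ord0).
  move=> Uy; apply: (hz2 _ (p i)); last exact: (hz3 _ _ Uy).2.
  by apply: (g_sym ge Dz2); have := hv i => /hz3[].
have ext (y y' : env M h) : y ord0 = y' ord0 :> H -> y = y'.
  by move=> yy; apply: fext => j; rewrite (ord1 j).
exists (env1 t') => // i y By; case: (I2 i) => Ei; subst i => /=.
  rewrite E1; split=> [Ry|->//]; apply: ext; apply: ht1 => //; exact: near.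
rewrite E2; split=> [Ry|->//]; apply: ext; apply: ht2 => //; exact: near.
Qed.

(** * Independent tuples and spanning sets *)

Definition indep C n (u : env M (power (home L) n)) :=
  forall i : 'I_n, ~ acl_home (C `|` elts_on u (fun j => j <> i)) (u i).

Definition seq_elts (ts : seq H) : set (element M) := [set p | exists2 t, List.In t ts & p = elt t].

Lemma minimal_subset n (S : {set 'I_n} -> Prop) I0 :
  S I0 -> exists2 I : {set 'I_n}, S I & forall J, S J -> #|I| <= #|J|.
Proof.
move=> SI0.
have hm : exists m, `[< exists2 I, S I & #|I| = m >] by exists #|I0|; apply/asboolP; exists I0.
have [m /asboolP[I SI Im] mmin] := ex_minnP hm.
exists I => // J SJ; rewrite Im; apply: mmin; apply/asboolP; by exists J.
Qed.

(** Transitivity of algebraic closure. It shows that a spanning subtuple of minimal length is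
    independent, without an exchange property. *)
Lemma spanning_drop C n (u : env M (power (home L) n)) (I : {set 'I_n}) (i : 'I_n) :
  i \in I -> acl_home (C `|` elts_on u (fun j => j \in I :\ i)%SET) (u i) ->
  (forall j : 'I_n, acl_home (C `|` elts_on u (fun j => j \in I)) (u j)) ->
  forall j : 'I_n, acl_home (C `|` elts_on u (fun j => j \in I :\ i)%SET) (u j).
Proof.
move=> iI ai aI j; apply: (acl_trans1 ai); apply: acl_mono (aI j).
move=> p [|[k kI ->]]; first by left; left.
have [->|ki] := eqVneq k i; first by right.
by left; right; exists k => //; rewrite !inE ki.
Qed.

(** Induction on ts. A minimal subset I of the entries of u that spans u over C and t is independent
    over these, so the induction hypothesis bounds its size by that of the remaining ts. Two indices
    outside I would give a pair independent over C and the entries in I, yet algebraic over these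
    and t, which [pair_not_spanned] excludes. So n exceeds the size of I by at most one. *)
Lemma indep_le e n C (u : env M (power (home L) n)) (ts : seq H) :
  good e -> ~ dp_rank_gt [set: env M h] 1 -> small C -> indep C u ->
  (forall i : 'I_n, acl_home (C `|` seq_elts ts) (u i)) -> n <= size ts.
Proof.
move=> ge ndp; elim: ts n C u => [|t ts IH] n C u sC iu su.
  case: n u iu su => // n u iu su; exfalso; apply: (iu ord0).
  by apply: acl_mono (su ord0) => p [|[]//]; left.
pose C1 := C `|` [set elt t].
have sC1 : small C1 by apply: small_setU => //; exact: finite_set1.
pose S (I : {set 'I_n}) := forall j : 'I_n, acl_home (C1 `|` elts_on u (fun j => j \in I)) (u j).
have [|I SI Imin] := @minimal_subset n S [set: 'I_n]%SET.
  by move=> j; apply: acl_self; right; exists j; rewrite ?inE.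
pose v : env M (power (home L) #|I|) := fun k => u (enum_val k).
have iv : indep C1 v.
  move=> k ak.
  have vI : enum_val k \in I by exact: enum_valP.
  have := Imin (I :\ enum_val k)%SET; rewrite leqNgt proper_card ?properD1 //=.
  move=> F; apply: notF; apply: F.
  apply: spanning_drop => //; apply: acl_mono ak => p [|[j jk ->]]; first by left.
  right; exists (enum_val j) => //; rewrite !inE enum_valP andbT.
  by apply/eqP => /enum_val_inj.
have hI : #|I| <= size ts.
  apply: (IH _ C1 v) => // k; apply: acl_mono (su (enum_val k)) => p [|[t' [<-|tt] ->]].
  - by left; left.
  - by left; right.
  - by right; exists t'.
rewrite /= leqNgt; apply/negP => nI.
have /card_gt1P[i [j [iI jI ij]]] : 1 < #|(~: I)%SET|.
  by rewrite cardsCs finset.setCK card_ord ltn_subRL; apply: leq_ltn_trans nI; rewrite addn1.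
move: iI jI; rewrite !inE => iI jI.
apply: (@pair_not_spanned e (C `|` elts_on u (fun j => j \in I)) (u i) (u j) t) => //.
- by apply: small_setU => //; exact: finite_elts_on.
- move=> a; apply: (iu i); apply: acl_mono a => p [[|[k kI ->]]|->].
  + by left.
  + by right; exists k => // E; move: iI; rewrite -E kI.
  + by right; exists j => // E; move: ij; rewrite E eqxx.
- move=> a; apply: (iu j); apply: acl_mono a => p [[|[k kI ->]]|->].
  + by left.
  + by right; exists k => // E; move: jI; rewrite -E kI.
  + by right; exists i => // E; move: ij; rewrite E eqxx.
- by apply: acl_mono (SI i) => p [[|->]|?]; [left; left|right|left; right].
- by apply: acl_mono (SI j) => p [[|->]|?]; [left; left|right|left; right].
Qed.

(** * Independent tuples inside boxes *)

Definition upd n m (f : {ffun 'I_n -> 'I_m}) i j : {ffun 'I_n -> 'I_m} :=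
  [ffun k => if k == i then j else f k].

Lemma updE n m (f : {ffun 'I_n -> 'I_m}) i j k : upd f i j k = if k == i then j else f k.
Proof. by rewrite ffunE. Qed.

(** On each line parallel to axis i at most [N i] of the m points are bad for i, hence at most a
    proportion [N i] / m of the whole grid is. These proportions add up to less than 1. *)
Lemma exists_good_point n m (N : 'I_n -> nat) (bad : 'I_n -> {ffun 'I_n -> 'I_m} -> bool) :
  (forall i f, #|[set j | bad i (upd f i j)]%SET| <= N i) -> \sum_i N i < m ->
  exists f, forall i, ~~ bad i f.
Proof.
move=> hbad Nm.
have count i : m * #|[set f | bad i f]%SET| <= #|{ffun 'I_n -> 'I_m}| * N i.
  have -> : m * #|[set f | bad i f]%SET| = \sum_(x : {ffun 'I_n -> 'I_m} * 'I_m) (bad i x.1 : nat).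
    rewrite -(pair_bigA _ (fun f j => (bad i f : nat))) /= exchange_big /= sum_nat_const card_ord.
    by rewrite -sum1dep_card big_mkcond.
  (* Exchanging j with the i-th coordinate of f is an involution; it turns m times the number of bad
     points into a count along the lines parallel to axis i. *)
  pose tau (x : {ffun 'I_n -> 'I_m} * 'I_m) := (upd x.1 i x.2, x.1 i).
  have tauK : cancel tau tau.
    move=> [f j]; rewrite /tau /=; congr (_, _); last by rewrite updE eqxx.
    by apply/ffunP => k; rewrite !updE; case: eqP => // ->.
  rewrite (reindex_inj (can_inj tauK)) /= -(pair_bigA _ (fun f j => (bad i (upd f i j) : nat))) /=.
  rewrite -sum_nat_const; apply: leq_sum => f _; apply: leq_trans (hbad i f).
  by rewrite -sum1dep_card [X in _ <= X]big_mkcond.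
have m0 : 0 < m by apply: leq_ltn_trans Nm.
have F0 : 0 < #|{ffun 'I_n -> 'I_m}| by rewrite card_ffun !card_ord expn_gt0 m0.
apply: contrapT => /forallNP no.
have cover : #|{ffun 'I_n -> 'I_m}| <= \sum_i #|[set f | bad i f]%SET|.
  have -> : #|{ffun 'I_n -> 'I_m}| = \sum_(f : {ffun 'I_n -> 'I_m}) 1 by rewrite sum1_card.
  under [X in _ <= X]eq_bigr do rewrite -sum1dep_card big_mkcond.
  rewrite [X in _ <= X]exchange_big /=; apply: leq_sum => f _.
  have /existsNP[i /negP/negPn bi] := no f.
  by rewrite (bigD1 i) //= bi.
have := leq_mul (leqnn m) cover; rewrite big_distrr /= leqNgt => /negP; apply.
apply: leq_ltn_trans (leq_sum _ (fun i _ => count i)) _.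
by rewrite -big_distrr /= mulnC ltn_pmul2r.
Qed.

(** A box contains arbitrarily large grids. The relation [R i] is bounded and ignores the i-th
    coordinate of its tuple, so on each line parallel to axis i it holds at no more than a fixed
    number of points, and [exists_good_point] finds a point avoiding all [R i]. Saturation then
    treats all R together. *)
Lemma int_indep e n C (Y : env M (power (home L) n) -> Prop) :
  good e -> small C -> Dp C Y -> has_int e Y -> exists2 u, Y u & indep C u.
Proof.
move=> ge sC dY iY.
pose ok (R : 'I_n -> env M (power (home L) n) -> H -> Prop) := forall i,
  [/\ def2 C (R i), exists N, forall u, ~ at_least N.+1 (R i u) &
    forall u1 u2, (forall j, j <> i -> u1 j = u2 j) -> forall y, R i u1 y -> R i u2 y].
pose Q (R : 'I_n -> env M (power (home L) n) -> H -> Prop) (u : env M (power (home L) n)) :=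
  Y u /\ forall i : 'I_n, ~ R i u (u i).
have ok0 : ok (fun _ _ _ => False).
  move=> i; split=> //; first by rewrite /def2; dp.
  by exists 0 => u; exact: not_at_least_False.
have okQ R : ok R -> exists u, Q R u.
  move=> okR.
  have /(_ _)/cid-/all_sig[N hN] i : exists N, forall u, ~ at_least N.+1 (R i u) by have [] :=
      okR i.
  pose m := (\sum_i N i).+1.
  have [s [si sY]] := int_grid m ge iY.
  have [||f hf] := @exists_good_point n m N (fun i f => `[< R i (point s f) (point s f i) >]).
  - move=> i f; rewrite leqNgt; apply/negP => hlt; apply: (hN i (point s f)).
    apply: (at_least_le hlt).
    exists (fun k => s (enum_rank (i, enum_val k)) : H); first by move=> k k' /si /enum_val_inj.
    move=> k; have := enum_valP k; rewrite inE => /asboolP.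
    rewrite (_ : point s (upd f i _) i = s (enum_rank (i, enum_val k)) :> H); last first.
      by rewrite /point updE eqxx.
    have [_ _ dep] := okR i; apply: dep => j ji.
    by rewrite /point updE; case: eqP.
  - by [].
  exists (point s f); split; first exact: sY.
  by move=> i Ri; have /negP := hf i; apply; exact/asboolP.
have [|||||u hu] := @saturation _ _ C _ (fun P => exists R, ok R /\ P = Q R) sat_M.
- by [].
- move=> _ [R [okR ->]]; apply Dp_and => //; apply Dp_allF => i; apply Dp_not.
  by have [dR _ _] := okR i; apply (def2_app dR); cm.
- by exists (Q (fun _ _ _ => False)); exists (fun _ _ _ => False).
- by move=> _ [R [okR ->]]; exact: okQ.
- move=> _ _ [R1 [ok1 ->]] [R2 [ok2 ->]].
  exists (Q (fun i u y => R1 i u y \/ R2 i u y)).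
    exists (fun i u y => R1 i u y \/ R2 i u y); split=> // i.
    have [d1 [N1 b1] p1] := ok1 i; have [d2 [N2 b2] p2] := ok2 i; split.
    + by rewrite /def2; dp.
    + by exists (N1 + N2) => v; exact: not_at_leastU.
    + by move=> u1 u2 E y [Ry|Ry]; [left; exact: p1 E _ Ry|right; exact: p2 E _ Ry].
  by move=> u [Yu nR]; split; split=> // i Ri; apply: (nR i); tauto.
exists u; first by have [] := hu _ (ex_intro _ _ (conj ok0 erefl)).
move=> i /acl_split[R [N [dR bR Ru dep]]].
(* The relation R is placed at index i, and the empty relation at all others. *)
pose Ri (k : 'I_n) := if k == i then R else fun _ _ => False.
have okRi : ok Ri.
  move=> k; rewrite /Ri; case: eqP => [->|_]; last exact: ok0.
  by split=> //; exists N.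
have [_ /(_ i)] := hu _ (ex_intro _ _ (conj okRi erefl)).
by rewrite /Ri eqxx.
Qed.

(** * Dimension in terms of boxes in projections *)

Section Dimension.
Variables (e : env M W) (k : nat).
Hypotheses (ge : good e) (ndp : ~ dp_rank_gt [set: env M h] 1).
Variables (C : set (element M)) (A : set (env M (power (home L) k))).
Hypotheses (sC : small C) (dA : Dp C A).

Definition proj m (g : {ffun 'I_m -> 'I_k}) : env M (power (home L) m) -> Prop :=
  fun u => exists a : env M (power (home L) k), A a /\ forall i : 'I_m, a (g i) = u i :> H.

Definition has_int_proj m := exists g : {ffun 'I_m -> 'I_k}, injective g /\ has_int e (proj g).

Lemma Dp_proj m (g : {ffun 'I_m -> 'I_k}) : Dp C (proj g).
Proof. by rewrite /proj; dp; apply (Dp_comp dA); cm. Qed.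

Lemma acl_spansE D (a : env M (power (home L) k)) (I : {set 'I_k}) :
  acl_spans D a I <-> forall j : 'I_k, acl_home (D `|` elts_on a (fun j => j \in I)) (a j).
Proof. by split=> sp j; apply/acl_homeE; exact: sp. Qed.

Lemma exists_tuple_dim (a : env M (power (home L) k)) : exists2 m, tuple_dim C a m & m <= k.
Proof.
have [|I SI Imin] := @minimal_subset k (acl_spans C a) [set: 'I_k]%SET.
  by apply/acl_spansE => j; apply: acl_self; right; exists j; rewrite ?inE.
exists #|I|; last by rewrite -[X in _ <= X]card_ord max_card.
by split=> //; exists I.
Qed.

(** A spanning subtuple of a of minimal length is independent over C, so [indep_int] applies to the
    corresponding projection. *)
Lemma tuple_dim_int (a : env M (power (home L) k)) m : A a -> tuple_dim C a m -> has_int_proj m.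
Proof.
move=> Aa [[I /acl_spansE SI Im] mmin]; subst m.
pose g : {ffun 'I_#|I| -> 'I_k} := [ffun i => enum_val i].
exists g; split; first by move=> i j; rewrite !ffunE => /enum_val_inj.
apply: (@indep_int e _ C _ (fun i => a (g i)) ge sC (Dp_proj g)); first by exists a.
move=> i ai; have iI : g i \in I by rewrite ffunE enum_valP.
have := mmin (I :\ g i)%SET; rewrite leqNgt proper_card ?properD1 //=.
move=> F; apply: notF; apply: F; apply/acl_spansE.
apply: spanning_drop => //; apply: acl_mono ai => p [|[j ji ->]]; first by left.
right; exists (g j) => //; rewrite !inE !ffunE enum_valP andbT.
by apply/eqP => /enum_val_inj.
Qed.

(** The box contains an independent m-tuple u, the projection of some a in A. Any subtuple of a that
    spans a also spans u, so by [indep_le] it has at least m entries. *)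
Lemma int_tuple_dim m : has_int_proj m ->
  exists2 a, A a & forall m', tuple_dim C a m' -> m <= m'.
Proof.
move=> [g [gi iY]]; have [u [a [Aa au]] iu] := int_indep ge sC (Dp_proj g) iY.
exists a => // _ [[I /acl_spansE SI <-] _].
have := @indep_le e m C u [seq (a j : H) | j <- enum I] ge ndp sC iu.
rewrite size_map -cardE; apply=> i; rewrite -au; apply: acl_mono (SI (g i)) => p [|[j jI ->]].
  by left.
right; exists (a j) => //; apply/(List.in_map (fun j => a j : H)).
have : j \in enum I by rewrite mem_enum.
elim: (enum I) => // x s IHs; rewrite inE => /orP[/eqP->|/IHs]; by [left|right].
Qed.

(** The right-hand side does not mention C, and it varies definably when A runs through a definable
    family. *)
Lemma dim_overP n : dim_over C A (Some n) <->
  has_int_proj n /\ forall m : 'I_k.+1, n < m -> ~ has_int_proj m.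
Proof.
split=> [[[a Aa an] nmax]|[hn nmax]].
  split; first exact: tuple_dim_int an.
  move=> m nm /int_tuple_dim[b Ab bm].
  have [m' hm' _] := exists_tuple_dim b.
  by have := leq_trans (bm _ hm') (nmax _ _ Ab hm'); rewrite leqNgt nm.
have ub a m : A a -> tuple_dim C a m -> m <= n.
  move=> Aa hm; rewrite leqNgt; apply/negP => nm.
  have [m' hm' m'k] := exists_tuple_dim a.
  have mk : m < k.+1.
    have [[I SI Im] _] := hm; rewrite ltnS -Im -[X in _ <= X]card_ord; exact: max_card.
  by apply: (nmax (Ordinal mk) nm); exact: tuple_dim_int hm.
split; last exact: ub.
have [a Aa na] := int_tuple_dim hn; exists a => //.
have [m hm _] := exists_tuple_dim a.
suff -> : n = m by [].
by apply/eqP; rewrite eqn_leq; apply/andP; split; [exact: na|exact: ub Aa hm].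
Qed.

End Dimension.

End Topology.

(** * The given uniform structure as a family with variable parameters *)

Section UniformStructure.
Variables (L : language) (M : structure L).
Local Notation H := (M (home L)).
Local Notation h := (single (home L)).
Variables (B : set (set (H * H))) (Z : ctx (lsort L)) (phi : pformula M (h (+) h (+) Z))
  (delta : pformula M Z).
Local Notation W := (pctx phi (+) pctx delta).

(** The parameters of the formula and of the index set are replaced by variables e, as required for
    comparing conjugates; [basic_params] are the original values. *)
Definition basic (e : env M W) (z : env M Z) (x y : H) :=
  sat (pform phi) (env1 x +++ env1 y +++ z +++ fstE e).

Definition basic_index (e : env M W) (z : env M Z) := sat (pform delta) (z +++ sndE e).

Definition basic_params : env M W := params phi +++ params delta.

Lemma basic_dp : Dp set0 (fun e : env M (((W (+) Z) (+) h) (+) h) =>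
  basic (fstE (fstE (fstE e))) (sndE (fstE (fstE e))) (sndE (fstE e) ord0) (sndE e ord0)).
Proof. by apply: (Dp_sat (pform phi)); cm. Qed.

Lemma basic_index_dp : Dp set0 (fun e : env M (W (+) Z) => basic_index (fstE e) (sndE e)).
Proof. by apply: (Dp_sat (pform delta)); cm. Qed.

Hypothesis BE : B = [set U | exists2 c, [set a | psat delta a] c &
  U = [set xy | psat phi (env1 xy.1 +++ env1 xy.2 +++ c)]].

Lemma basic_in z : basic_index basic_params z -> B [set xy | basic basic_params z xy.1 xy.2].
Proof. by move=> Dz; rewrite BE; exists z. Qed.

Lemma in_basic U : B U -> exists z, basic_index basic_params z /\
  forall x y, U (x, y) <-> basic basic_params z x y.
Proof. by rewrite BE => -[z Dz ->]; exists z. Qed.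

(** If there were only one point, it would have to realize two different choices from the same
    infinite set. *)
Lemma dp_rank_ge1_nontrivial : dp_rank_gt [set: env M h] 0 -> ~ (forall x y : H, x = y).
Proof.
move=> [D [psi [Bs [iB hB]]]] triv.
have /(_ _)/cid-/all_sig[b hb] i : exists y, Bs i y by exact: infinite_setN0 (iB i).
have /(_ _)/cid-/all_sig[b' hb'] i : exists y, (Bs i `\` [set b i]) y.
  exact: infinite_setN0 (infinite_setD (iB i) (finite_set1 _)).
have [a _ ha] := hB b hb.
have [a' _ ha'] := hB b' (fun i => (hb' i).1).
have aa : a = a' by apply: fext => i; exact: triv.
have [Bb nb] := hb' ord0; apply: nb; apply/(ha ord0 _ Bb); rewrite aa.
exact/(ha' ord0 _ Bb).
Qed.

Lemma good_basic : definable_uniform_structure B -> dp_rank_gt [set: env M h] 0 ->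
  no_isolated_points B -> infinite_definable_interior B ->
  good basic basic_index basic_params.
Proof.
move=> [_ diag sym cap comp] rk iso inter.
have diagE x y : (forall z, basic_index basic_params z -> basic basic_params z x y) <-> x = y.
  have := congr1 (fun A : set (H * H) => A (x, y)) diag => /= <-; split=> hxy.
    by move=> U /in_basic[z [Dz Uz]]; apply/Uz; exact: hxy.
  by move=> z /basic_in; exact: hxy.
split=> //.
- by move=> z /basic_in /sym s x y; exact: s.
- move=> z z' /basic_in Bz /basic_in Bz'; have [V /in_basic[z'' [Dz'' Vz'']] VU] := cap _ _ Bz Bz'.
  by exists z''; split=> // x y /Vz''/VU.
- move=> z /basic_in /comp[V /in_basic[z' [Dz' Vz']] VU]; exists z'; split=> // x y t xy yt.
  by apply: (VU (x, t)); exists y; split; apply/Vz'.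
- move=> z x Dz; apply: contrapT => /forallNP no; apply: (iso x) => x' ->.
  exists [set xy | basic basic_params z xy.1 xy.2]; first exact: basic_in.
  by move=> y /= xy; apply: contrapT => yx; apply: (no y).
(* Without any index the intersection of the entourages would be everything, and all points would be
   equal by [diagE]. *)
- apply: contrapT => /forallNP no; apply: (dp_rank_ge1_nontrivial rk) => x y.
  by apply/diagE => z /no.
- move=> X dX iX; have [|x [O [openO OX Ox]]] := inter [set x | X x] _ iX.
    by apply/Dp_definable_over.
  have [U /in_basic[z [Dz Uz]] UO] := openO x Ox.
  by exists x, z; split=> // y /Uz /UO /OX.
Qed.

End UniformStructure.

(* d ranges over the possible values -oo (None) and n <= k of the dimension. *)
Theorem corollary2p5 (L : language) (T : set (sentence L)) (M : structure L)
  (B : set (set (M (home L) * M (home L)))) :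
  complete T -> NIP T -> models M T -> saturated M -> dp_minimal M ->
  definable_uniform_structure B -> no_isolated_points B ->
  infinite_definable_interior B ->
  forall (l k : nat)
    (D : env M (power (home L) l) -> set (env M (power (home L) k))),
  definable_family D ->
  forall d : option nat, (if d is Some n then is_true (n <= k) else True) ->
  definable [set x | dim (D x) d].
Proof.
move=> _ _ _ sat_M [rk1 nrk2] uB iso inter l k D [psi DE] d _.
have dD : Dp setT (fun v : env M (power (home L) l (+) power (home L) k) => D (fstE v) (sndE v)).
  apply: (@eq_Dp _ _ _ _ _ (psat psi)) => [v|]; first by rewrite DE /= cat_fst_snd.
  by apply/Dp_definable_over; exists psi.
have small_D x : exists2 C, small C & Dp C (D x).
  by apply: Dp_small; apply (Dp_app2 dD); cm.
apply/Dp_definable_over.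
case: d => [n|]; last first.
  apply: (@eq_Dp _ _ _ _ _ (fun x => forall a : env M (power (home L) k), ~ D x a)); last first.
    by dp; apply (Dp_app2 dD); cm.
  move=> x; split=> [[C [_ _ /= E]] a|nD]; first by rewrite E.
  have [C sC dC] := small_D x; exists C; split=> //; first exact/Dp_definable_over.
  by apply/seteqP; split.
have [[Z [phi [Dz [[delta _ DzE] BE]]]] _ _ _ _] := uB.
rewrite DzE in BE.
have ge := good_basic BE uB rk1 iso inter.
pose U_ := @basic L M Z phi delta; pose D_ := @basic_index L M Z phi delta.
pose e := @basic_params L M Z phi delta.
have U_dp := basic_dp phi delta; have D_dp := basic_index_dp phi delta.
pose cond x := has_int_proj U_ D_ e (D x) n /\
  forall m : 'I_k.+1, n < m -> ~ has_int_proj U_ D_ e (D x) m.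
(* The parameter set over which the dimension of [D x] is computed varies with x, but [cond x] does
   not depend on it. *)
apply: (@eq_Dp _ _ _ _ _ cond) => [x|].
  have P := dim_overP sat_M U_dp D_dp ge nrk2.
  split=> [[C [sC /Dp_definable_over dC /P h]]|c]; first exact: h.
  have [C sC dC] := small_D x; exists C; split=> //; first exact/Dp_definable_over.
  exact/P.
have dh m : Dp setT (fun x => has_int_proj U_ D_ e (D x) m).
  rewrite /has_int_proj; dp.
  have ce G : cmap setT (fun _ : env M G => e) by apply: cmap_cst.
  rewrite /has_int /proj; dp.
  - by apply (adm_app D_dp); cm.
  - by apply (ent_app U_dp); cm.
  - by apply (Dp_app2 dD); cm.
by rewrite /cond; dp.
Qed.
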